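(* Let $G$ be a hypergraph with incidence matrix $A\in\mathbb{N}^{n\times m}$ (all columns nonzero). The policy VQML (Virtual-Queue Match-the-Longest), which is defined from $G$ alone, with no knowledge of $\lambda$ and no parameter, stabilizes $(G,\lambda)$ for every $\lambda\in\mathbb{R}_{>0}^n$ such that $A$ is surjective and $A\mu=\lambda$ for some $\mu$ with $\mu_k>0$ for all $k$ (equivalently $\lambda\in\operatorname{int}\operatorname{cone}(A)$). Consequently VQML is maximally stable: it stabilizes every stabilizable problem $(G,\lambda)$.
   Context: $\mathbb{N}$ contains $0$. A hypergraph $G=(V,E)$ has classes $V=\{1,\dots,n\}$ and hyperedges $E=\{1,\dots,m\}$, described by $A\in\mathbb{N}^{n\times m}$ with nonzero columns $A_k$: activating $k$ removes $A_{i,k}$ items of class $i$. $\operatorname{cone}(A)=A\,\mathbb{R}_{\ge0}^m$; $A$ is surjective if $A\mathbb{R}^m=\mathbb{R}^n$. Model. Items of class $i$ arrive one at a time by independent Poisson processes of rates $\lambda_i>0$; $\Lambda=\sum_i\lambda_i$, $\bar\lambda=\lambda/\Lambda$, so arrival classes at successive epochs $t=0,1,\dots$ are i.i.d. with law $\bar\lambda$. A matching policy consists of a countable set of internal states with a distinguished initial value and a (possibly randomized) time-homogeneous rule which, at each arrival epoch, as a function of the current state $S(t)=(X(t),\text{internal state})$ (with $X(t)\in\mathbb{N}^n$ the queues) and of the arrival $a(t)\in\{e_1,\dots,e_n\}$ alone, chooses activation numbers $s\in\mathbb{N}^m$ with $As\le X(t)+a(t)$ and the next internal state; then $X(t+1)=X(t)+a(t)-As$.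 The number of activations per epoch is uniformly bounded. The system starts empty ($X(0)=0$, initial internal state). A policy stabilizes $(G,\lambda)$ if the embedded Markov chain $(S(t))_{t\in\mathbb{N}}$ is positive recurrent on the communicating class of the initial state; $(G,\lambda)$ is stabilizable if some policy stabilizes it. VQML. The full state is $S(t)=(X(t),Q(t),B(t))$ where $X(t)\in\mathbb{N}^n$ counts all physical items present, $Q(t)\in\mathbb{Z}^n$ is a signed virtual queue, and $B(t)$ is a finite ordered list (oldest first) of backlog entries $(k,c)$ with $k\in E$, $c\in\mathbb{N}^n$, $c\le A_k$, $c\ne A_k$ ($c$ records how many physical items of each class have been assigned to this virtually activated, not yet completed matching). Let $W=\sum_{(k,c)\in B}c$ be the assigned counts and $U=X-W\ge 0$ the unassigned counts. Start: $S(0)=(0,0,\text{empty list})$. At epoch $t$ with arrival $a(t)=e_i$, in this order: (E1) Choose $s(t)=s(Q(t))$, where $s(q)$ is a maximizer of $\langle q,As\rangle$ over $s\in\mathbb{N}^m$ with $\|s\|_1\le 2$, selected by the canonical rule: $s(q)=0$ if $\max_k\langle q,A_k\rangle\le 0$; otherwise the lexicographically smallest among the maximizers of smallest $\ell_1$-norm. (E2) $Q(t+1)=Q(t)+a(t)-As(t)$. (E3) For each $k$, in increasing order, append $s_k(t)$ entries $(k,0)$ at the tail of the list. (E4) The arriving item joins the unassigned pool ($X\leftarrow X+e_i$, $U\leftarrow U+e_i$). (E5) Scan the list from head to tail; at each entry $(k,c)$ and for each class $j$, assign $\min(U_j,A_{j,k}-c_j)$ unassigned class-$j$ items to the entry ($U_j$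 decreases and $c_j$ increases by that amount). (E6) Remove every entry with $c=A_k$; each such removal is a physical activation of $k$, and $X$ decreases by $A_k$. The result is $S(t+1)$. The internal state of VQML is $(Q,B)$. *)

(* Defs.v *)
From HB Require Import structures.
From mathcomp Require Import all_boot all_order all_algebra.
From mathcomp Require Import all_classical all_reals all_analysis.

Set Implicit Arguments.
Unset Strict Implicit.
Unset Printing Implicit Defensive.

Import Order.TTheory GRing.Theory Num.Theory.
Import numFieldNormedType.Exports.

Local Open Scope classical_set_scope.
Local Open Scope ring_scope.

(** * Markov chains on a countable state space, given by a transition matrix *)

Definition step_prob (R : realType) (S : countType) (P : S -> S -> \bar R) :=
  fix step_prob (t : nat) (x y : S) : \bar R :=
    if t is t'.+1 then (\esum_(z in [set: S]) (P x z * step_prob t' z y))%E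
    else ((x == y)%:R)%:E.

Definition accessible (R : realType) (S : countType) (P : S -> S -> \bar R)
    (x y : S) : Prop :=
  exists t : nat, (0 < step_prob P t x y)%E.

Definition communicating_class (R : realType) (S : countType)
    (P : S -> S -> \bar R) (x : S) : set S :=
  [set y | accessible P x y /\ accessible P y x].

(* Probability, starting from x, that the first visit to y at a time >= 1
   takes place at time t.+1. *)
Definition first_passage (R : realType) (S : countType) (P : S -> S -> \bar R) :=
  fix first_passage (t : nat) (x y : S) : \bar R :=
    if t is t'.+1 then (\esum_(z in [set~ y]) (P x z * first_passage t' z y))%E
    else P x y.

(* The return time to x is almost surely finite and has finite mean. *)
Definition positive_recurrent (R : realType) (S : countType)
    (P : S -> S -> \bar R) (x : S) : Prop :=
  (\sum_(0 <= t <oo) first_passage P t x x = 1)%E /\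
  (\sum_(0 <= t <oo) (t.+1%:R)%:E * first_passage P t x x < +oo)%E.

(** * Matching policies *)

(* Truncated subtraction, entry by entry. *)
Definition subv (n : nat) (u v : 'cV[nat]_n) : 'cV[nat]_n :=
  \col_j (u j ord0 - v j ord0)%N.

Definition lev (n : nat) (u v : 'cV[nat]_n) : Prop :=
  forall j, (u j ord0 <= v j ord0)%N.

Definition norm1 (m : nat) (s : 'cV[nat]_m) : nat := (\sum_k s k ord0)%N.

(* [rule x z i (s, z')] is the probability of choosing the activation numbers s
   and the next internal state z' in state (x, z) upon an arrival of class i. *)
Record prepolicy (R : realType) (n m : nat) := Prepolicy {
  internal : countType;
  init : internal;
  rule : 'cV[nat]_n -> internal -> 'I_n -> 'cV[nat]_m * internal -> R
}.

Definition state (R : realType) (n m : nat) (p : prepolicy R n m) : countType :=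
  ('cV[nat]_n * internal p)%type.

Definition init_state (R : realType) (n m : nat) (p : prepolicy R n m) :
  state p := (0, init p).

Definition next_queues (n m : nat) (A : 'M[nat]_(n, m)) (x : 'cV[nat]_n)
    (i : 'I_n) (s : 'cV[nat]_m) : 'cV[nat]_n :=
  subv (x + delta_mx i 0) (A *m s).

(* States visited with positive probability from the initial state; since all
   arrival rates are positive, this does not depend on them. *)
Inductive reachable (R : realType) (n m : nat) (A : 'M[nat]_(n, m))
    (p : prepolicy R n m) : 'cV[nat]_n -> internal p -> Prop :=
| reachable_init : reachable A 0 (init p)
| reachable_step x z i s z' :
    reachable A x z -> 0 < rule x z i (s, z') ->
    reachable A (next_queues A x i s) z'.

(* Feasibility and the uniform bound on the number of activations only concern
   the states that the system, started empty, can visit: a policy such as VQML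
   relies on relations between the queues and the internal state that fail in
   other pairs (x, z). *)
Definition is_policy (R : realType) (n m : nat) (A : 'M[nat]_(n, m))
    (p : prepolicy R n m) : Prop :=
  [/\ forall x (z : internal p) i sz, 0 <= rule x z i sz,
      forall x (z : internal p) i,
        (\esum_(sz in [set: 'cV[nat]_m * internal p]) (rule x z i sz)%:E = 1)%E,
      forall x (z : internal p) i s z',
        reachable A x z -> 0 < rule x z i (s, z') ->
        lev (A *m s) (x + delta_mx i 0) &
      exists K : nat, forall x (z : internal p) i s z',
        reachable A x z -> 0 < rule x z i (s, z') -> (norm1 s <= K)%N].

(* Transition matrix of the chain embedded at the arrival epochs of independent
   Poisson processes of rates lambda: the arrival is of class i with probability
   lambda_i / sum_j lambda_j, independently of the past. *)
Definition transition (R : realType) (n m : nat) (A : 'M[nat]_(n, m))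
    (lambda : 'cV[R]_n) (p : prepolicy R n m) (x y : state p) : \bar R :=
  (\sum_(i < n) (lambda i 0 / \sum_j lambda j 0)%:E *
     \esum_(s in [set s | next_queues A x.1 i s = y.1])
        (rule x.1 x.2 i (s, y.2))%:E)%E.

Definition stabilizes (R : realType) (n m : nat) (A : 'M[nat]_(n, m))
    (lambda : 'cV[R]_n) (p : prepolicy R n m) : Prop :=
  forall x, communicating_class (transition A lambda (p := p)) (init_state p) x ->
    positive_recurrent (transition A lambda (p := p)) x.

Definition stabilizable (R : realType) (n m : nat) (A : 'M[nat]_(n, m))
    (lambda : 'cV[R]_n) : Prop :=
  exists p : prepolicy R n m, is_policy A p /\ stabilizes A lambda p.

Definition maximally_stable (R : realType) (n m : nat) (A : 'M[nat]_(n, m))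
    (p : prepolicy R n m) : Prop :=
  forall lambda : 'cV[R]_n, (forall i, 0 < lambda i 0) ->
    stabilizable A lambda -> stabilizes A lambda p.

(** * Virtual-Queue Match-the-Longest *)

Definition pairing (n : nat) (q : 'cV[int]_n) (v : 'cV[nat]_n) : int :=
  \sum_j q j 0 * (v j 0)%:Z.

Definition maximizer (n m : nat) (A : 'M[nat]_(n, m)) (q : 'cV[int]_n)
    (s : 'cV[nat]_m) : Prop :=
  (norm1 s <= 2)%N /\
  forall s' : 'cV[nat]_m, (norm1 s' <= 2)%N ->
    pairing q (A *m s') <= pairing q (A *m s).

Definition min_norm_maximizer (n m : nat) (A : 'M[nat]_(n, m)) (q : 'cV[int]_n)
    (s : 'cV[nat]_m) : Prop :=
  maximizer A q s /\
  forall s' : 'cV[nat]_m, maximizer A q s' -> (norm1 s <= norm1 s')%N.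

Definition lexi_le (m : nat) (s s' : 'cV[nat]_m) : bool :=
  (([seq s k 0 | k <- enum 'I_m] : seqlexi nat)
     <= [seq s' k 0 | k <- enum 'I_m])%O.

Definition canonical_choice (n m : nat) (A : 'M[nat]_(n, m)) (q : 'cV[int]_n)
    (s : 'cV[nat]_m) : Prop :=
  if `[< forall k : 'I_m, pairing q (col k A) <= 0 >] then s = 0
  else min_norm_maximizer A q s /\
       forall s' : 'cV[nat]_m, min_norm_maximizer A q s' -> lexi_le s s'.

(* [canonical_choice A q] is a singleton for every q, so that the default value
   of [xget] is never used. *)
Definition virtual_choice (n m : nat) (A : 'M[nat]_(n, m)) (q : 'cV[int]_n) :
  'cV[nat]_m := xget 0 [set s | canonical_choice A q s].

(* The conditions c <= A_k and c != A_k on a backlog entry (k, c) are not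
   imposed by the type; they hold in all reachable states. *)
Definition entry (n m : nat) : countType := ('I_m * 'cV[nat]_n)%type.

Definition assigned (n m : nat) (B : seq (entry n m)) : 'cV[nat]_n :=
  \sum_(e <- B) e.2.

Definition new_entries (n m : nat) (s : 'cV[nat]_m) : seq (entry n m) :=
  flatten [seq nseq (s k 0) (k, 0) | k <- enum 'I_m].

Fixpoint scan (n m : nat) (A : 'M[nat]_(n, m)) (U : 'cV[nat]_n)
    (B : seq (entry n m)) : seq (entry n m) :=
  if B is (k, c) :: B' then
    let g := \col_j minn (U j 0) (A j k - c j ord0)%N in
    (k, c + g) :: scan A (subv U g) B'
  else [::].

Definition complete (n m : nat) (A : 'M[nat]_(n, m)) (e : entry n m) : bool :=
  e.2 == col e.1 A.

Definition vqml_step (n m : nat) (A : 'M[nat]_(n, m)) (x : 'cV[nat]_n)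
    (z : 'cV[int]_n * seq (entry n m)) (i : 'I_n) :
    'cV[nat]_m * ('cV[int]_n * seq (entry n m)) :=
  let: (q, B) := z in
  let s := virtual_choice A q in
  let q' := q + delta_mx i 0 - map_mx Posz (A *m s) in
  let U := subv x (assigned B) + delta_mx i 0 in
  let B' := scan A U (B ++ new_entries n s) in
  (\col_k count (fun e : entry n m => complete A e && (e.1 == k)) B',
   (q', [seq e <- B' | ~~ complete A e])).

Definition VQML (R : realType) (n m : nat) (A : 'M[nat]_(n, m)) :
    prepolicy R n m :=
  @Prepolicy R n m ('cV[int]_n * seq (entry n m))%type (0, [::])
    (fun x z i sz => (sz == vqml_step A x z i)%:R).

(** * The cone of a hypergraph *)

Definition real_mx (R : realType) (n m : nat) (A : 'M[nat]_(n, m)) :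
  'M[R]_(n, m) := map_mx (fun a : nat => a%:R) A.

Definition surjective_mx (R : realType) (n m : nat) (A : 'M[nat]_(n, m)) : Prop :=
  forall y : 'cV[R]_n, exists x : 'cV[R]_m, real_mx R A *m x = y.

Definition cone (R : realType) (n m : nat) (A : 'M[nat]_(n, m)) : set 'cV[R]_n :=
  [set real_mx R A *m mu | mu in [set mu : 'cV[R]_m | forall k, 0 <= mu k 0]].

(* Main.v *)
Require Import Defs.
From HB Require Import structures.
From mathcomp Require Import all_boot all_order all_algebra.
From mathcomp Require Import all_classical all_reals all_analysis.
From mathcomp Require Import zify ring lra.

Set Implicit Arguments.
Unset Strict Implicit.
Unset Printing Implicit Defensive.

Import Order.TTheory GRing.Theory Num.Theory.
Import numFieldNormedType.Exports.

Local Open Scope classical_set_scope.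
Local Open Scope ring_scope.

(* Once a virtual queue is maintained, no class has both unassigned items and
   missing items: X = Q + sum of A_k over the backlog, and the unassigned and
   missing counts of a class are the positive and negative parts of Q. So Q = 0
   only in the empty state, and the full chain is controlled by Q, which
   evolves by itself. Maximizing <Q, As> over ||s|| <= 2 gives |Q|^2 a drift
   -2g + O(1) where g dominates |Q|_1: the factor 2 makes the matching
   capacity exceed the normalized rates. From any Q, suitable arrivals lead to
   Q = 0 in a number of steps bounded in terms of |Q|_1. Foster's criterion then
   gives positive recurrence.

   Conversely, if lambda is not interior to the cone, Farkas' lemma gives v <> 0
   with <v, A_k> <= 0 for all k and <v, lambda> >= 0. Under any policy <v, X> has
   increments of nonnegative conditional mean that do not vanish identically,
   which is incompatible with a finite mean return time to the empty state. *)

(** * Taboo operator and positive recurrence *)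

(** One activation per epoch would not do: if [A] is the identity and all virtual queues equal the
    same positive number, the linear part of the drift of |Q|^2 vanishes for every arrival law. The
    second activation leaves a surplus of at least one maximal weight. The positivity of each mu_k
    then controls every edge weight <Q, A_k>, of either sign, and surjectivity recovers Q from these
    weights. The guarantees of a policy hold only along reachable states, so the Markov chain lemmas
    are relative to a closed set [D]. Recurrence of a state x of the class is proved directly, by
    arrivals that lead through the empty state to x. For the converse, the square of <v, X> would
    detect nonzero increments, but it need not be integrable over an excursion whose length only has
    a finite mean. It is replaced by a bounded function that is quadratic near 0; the error made
    elsewhere is charged to the tail of the excursion. *)

Lemma ge0_esumZl (R : realType) (T : choiceType) (I : set T) (c : \bar R)
    (a : T -> \bar R) : (0 <= c)%E -> (forall i, 0 <= a i)%E ->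
  (\esum_(i in I) (c * a i) = c * \esum_(i in I) a i)%E.
Proof.
move=> + a0; case: c => [r|_|//] /=; last first.
  have le1 i (b : T -> \bar R) : I i -> (forall i, 0 <= b i)%E ->
      (b i <= \esum_(i in I) b i)%E.
    move=> Ii b0; apply: esum_ge; exists [set i]; last by rewrite fsbig_set1.
    by split=> // _ ->.
  have [[i Ii ai]|/forall2NP H] := pselect (exists2 i, I i & a i != 0%E).
    have ai0 : (0 < a i)%E by rewrite lt_def ai a0.
    rewrite [RHS]gt0_mulye; last exact: lt_le_trans ai0 (le1 _ _ Ii a0).
    have := le1 i (fun j => (+oo * a j)%E) Ii (fun j => mule_ge0 le0y (a0 j)).
    by rewrite gt0_mulye// leye_eq => /eqP.
  have a00 i : I i -> a i = 0%E.
    by move=> Ii; have [//|/negP] := H i; rewrite negbK => /eqP.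
  by rewrite !esum1 ?mule0// => i /a00 ->; rewrite mule0.
rewrite lee_fin => r0; rewrite /esum -ereal_supZl//; last first.
  by apply/set0P; exists (\sum_(x \in set0) a x)%E; exists set0 => //; exact: fsets_set0.
congr ereal_sup; apply/seteqP; split => [_ [A fA <-]|_ [_ [A fA <-] <-]] /=.
  exists (\sum_(x \in A) a x)%E; first by exists A.
  exact: ge0_mule_fsumr.
by exists A => //; rewrite ge0_mule_fsumr.
Qed.

Section taboo.
Variables (R : realType) (S : countType) (P : S -> S -> \bar R) (x : S).
Hypothesis P_ge0 : forall y z, (0 <= P y z)%E.
Variable D : set S.
Hypothesis P_closed : forall y z, D y -> (0 < P y z)%E -> D z.
Hypothesis P_stoch : forall y, D y -> (\esum_(z in [set: S]) P y z = 1)%E.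
Implicit Types g h : S -> \bar R.

(** The kernel [P] killed on entering [x]: [iter t taboo g y] is the mean of [g] at time t, from
    [y], on the event that [x] is not visited at times 1, ..., t. The starting point may be [x]
    itself, as return times require. *)
Definition taboo g (y : S) : \bar R := (\esum_(z in [set~ x]) (P y z * g z))%E.

Lemma first_passageE t y : first_passage P t y x = iter t taboo (P^~ x) y.
Proof.
by elim: t y => //= t IH y; apply: eq_esum => z _; rewrite IH.
Qed.

Lemma taboo_ge0 g y : (forall z, 0 <= g z)%E -> (0 <= taboo g y)%E.
Proof. by move=> g0; apply: esum_ge0 => z _; exact: mule_ge0. Qed.

Lemma iter_taboo_ge0 t g y : (forall z, 0 <= g z)%E -> (0 <= iter t taboo g y)%E.
Proof. by move=> g0; elim: t y => //= t IH y; exact: taboo_ge0. Qed.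

Lemma le_taboo_succ g h y : (forall z, 0 < P y z -> g z <= h z)%E ->
  (taboo g y <= taboo h y)%E.
Proof.
move=> gh; apply: le_esum => z _.
have [/eqP <-|Pyz] := boolP (0%E == P y z); first by rewrite !mul0e.
by apply: lee_wpmul2l => //; apply: gh; rewrite lt_def eq_sym Pyz P_ge0.
Qed.

Lemma le_taboo g h y : (forall z, D z -> g z <= h z)%E -> D y ->
  (taboo g y <= taboo h y)%E.
Proof. by move=> gh Dy; apply: le_taboo_succ => z /(P_closed Dy)/gh. Qed.

Lemma le_iter_taboo t g h y : (forall z, D z -> g z <= h z)%E -> D y ->
  (iter t taboo g y <= iter t taboo h y)%E.
Proof. by move=> gh; elim: t y => [|t IH] y Dy /=; [exact: gh|exact: le_taboo]. Qed.

Lemma iter_tabooD t g h : (forall z, 0 <= g z)%E -> (forall z, 0 <= h z)%E ->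
  iter t taboo (g \+ h)%E = (iter t taboo g \+ iter t taboo h)%E.
Proof.
move=> g0 h0; elim: t => //= t ->; apply/funext => y /=.
rewrite /taboo -esumD//; last 2 first.
- by move=> z _; apply: mule_ge0 => //; exact: iter_taboo_ge0.
- by move=> z _; apply: mule_ge0 => //; exact: iter_taboo_ge0.
apply: eq_esum => z _; rewrite ge0_muleDr//; exact: iter_taboo_ge0.
Qed.

Lemma iter_tabooZ t (c : R) g : 0 <= c -> (forall z, 0 <= g z)%E ->
  iter t taboo (fun y => c%:E * g y)%E = (fun y => c%:E * iter t taboo g y)%E.
Proof.
move=> c0 g0; elim: t => //= t ->; apply/funext => y /=.
rewrite /taboo -ge0_esumZl//; last by move=> z; apply: mule_ge0 => //; exact: iter_taboo_ge0.
by apply: eq_esum => z _; rewrite muleCA.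
Qed.

Lemma tabooE g y : (forall z, 0 <= g z)%E ->
  (\esum_(z in [set: S]) (P y z * g z) = P y x * g x + taboo g y)%E.
Proof.
move=> g0; rewrite (esumID [set x])//; last by move=> z _; exact: mule_ge0.
by rewrite !setTI esum_set1//; exact: mule_ge0.
Qed.

Lemma taboo1 y : D y -> (P y x + taboo (fun=> 1) y = 1)%E.
Proof.
move=> Dy; rewrite -[P y x]mule1 -(tabooE y (fun=> lee01)) -[RHS](P_stoch Dy).
by apply: eq_esum => z _; rewrite mule1.
Qed.

Lemma taboo1_le1 y : D y -> (taboo (fun=> 1) y <= 1)%E.
Proof. by move=> Dy; rewrite -[leRHS](taboo1 Dy) leeDr. Qed.

Lemma iter_taboo1_anti t y : D y ->
  (iter t.+1 taboo (fun=> 1) y <= iter t taboo (fun=> 1) y)%E.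
Proof. by move=> Dy; rewrite iterSr; apply: le_iter_taboo => // z /taboo1_le1. Qed.

Lemma iter_taboo1_le t s y : D y -> (s <= t)%N ->
  (iter t taboo (fun=> 1) y <= iter s taboo (fun=> 1) y)%E.
Proof.
move=> Dy /subnK <-; elim: (t - s)%N => // k IH.
by rewrite addSn; apply: le_trans IH; exact: iter_taboo1_anti.
Qed.

Lemma iter_taboo1_le1 t y : D y -> (iter t taboo (fun=> 1) y <= 1)%E.
Proof. by move=> Dy; exact: (iter_taboo1_le Dy (leq0n t)). Qed.

(** * Survival probabilities and the mean return time *)

Definition survival t y : R := fine (iter t taboo (fun=> 1%E) y).

Lemma survivalE t y : D y -> iter t taboo (fun=> 1%E) y = (survival t y)%:E.
Proof.
move=> Dy; rewrite /survival fineK// ge0_fin_numE ?iter_taboo_ge0//.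
by rewrite (le_lt_trans (iter_taboo1_le1 t Dy))// ltry.
Qed.

Lemma survival_ge0 t y : 0 <= survival t y.
Proof. by apply: fine_ge0; exact: iter_taboo_ge0. Qed.

Lemma survival_le t s y : D y -> (s <= t)%N -> survival t y <= survival s y.
Proof. by move=> Dy /(iter_taboo1_le Dy); rewrite !survivalE// lee_fin. Qed.

(** Iterate [taboo] t times on the one-step identity P(., x) + taboo 1 = 1, valid on [D]. *)
Lemma first_passage_survival t y : D y ->
  first_passage P t y x = (survival t y - survival t.+1 y)%:E.
Proof.
move=> Dy; have : (iter t taboo (P^~ x \+ taboo (fun=> 1)) y =
    iter t taboo (fun=> 1) y)%E.
  by apply/eqP; rewrite eq_le !le_iter_taboo// => z /taboo1 /= ->.
rewrite iter_tabooD//=; last by move=> z; exact: taboo_ge0.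
rewrite -iterSr !survivalE// -first_passageE EFinB => <-.
by rewrite addeK.
Qed.

Lemma sum_first_passage n y : D y ->
  (\sum_(0 <= t < n) first_passage P t y x = (1 - survival n y)%:E)%E.
Proof.
move=> Dy; elim: n => [|n IH]; first by rewrite big_nil /survival /= subrr.
rewrite big_nat_recr//= IH first_passage_survival// -EFinD; congr EFin; ring.
Qed.

(** Abel summation; the boundary term n * survival n is spread over the sum, which keeps every
    summand nonnegative. *)
Lemma sum_first_passage_mean n y : D y ->
  (\sum_(0 <= t < n) (t.+1%:R)%:E * first_passage P t y x =
   (\sum_(0 <= t < n) (survival t y - survival n y))%:E)%E.
Proof.
move=> Dy; elim: n => [|n IH]; first by rewrite !big_nil.
rewrite !big_nat_recr//= IH first_passage_survival// -EFinM -EFinD; congr EFin.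
rewrite !sumrB !big_const_nat !iter_addr_0 !subn0; ring.
Qed.

Lemma positive_recurrentP : D x -> positive_recurrent P x <->
  exists W : R, forall n, \sum_(0 <= t < n) survival t x <= W.
Proof.
move=> Dx.
have fp0 t : (0 <= first_passage P t x x)%E.
  by rewrite first_passageE; exact: iter_taboo_ge0.
have tfp0 t : (0 <= (t.+1%:R)%:E * first_passage P t x x)%E by exact: mule_ge0.
split=> [[fp1 tfp]|[W HW]].
  exists (fine (\sum_(0 <= t <oo) (t.+1%:R)%:E * first_passage P t x x)%E) => n.
  set E := fine _.
  have HE k : \sum_(0 <= t < k) (survival t x - survival k x) <= E.
    rewrite -lee_fin -sum_first_passage_mean// /E fineK.
      by apply: nneseries_lim_ge => *; exact: tfp0.
    by rewrite ge0_fin_numE//; apply: nneseries_ge0 => *; exact: tfp0.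
  have r0 : survival ^~ x @ \oo --> (0 : R).
    have : (fun k => (1 - survival k x)%:E) @ \oo --> 1%:E.
      rewrite -fp1; have := @is_cvg_nneseries R (fun t => first_passage P t x x) xpredT 0.
      move=> /(_ (fun n _ _ => fp0 n)) H.
      rewrite (_ : (fun k => _) = fun k => (\sum_(0 <= t < k) first_passage P t x x)%E) //.
      by apply/funext => k; rewrite sum_first_passage.
    move=> /fine_cvgP[_ /= H].
    rewrite (_ : survival^~ x = fun k => 1 - (fine \o (fun k => (1 - survival k x)%:E)) k).
      by rewrite -[0](subrr 1); apply: cvgB => //; exact: cvg_cst.
    by apply/funext => k /=; lra.
  (* Only n terms are kept while the boundary time is k + n: for fixed n the error n * survival (k +
     n) vanishes as k grows. *)
  have H k : \sum_(0 <= t < n) survival t x <= E + n%:R * survival (k + n) x.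
    have := HE (k + n)%N.
    rewrite (@big_cat_nat _ _ _ n)//= ?leq_addl// sumrB big_const_nat iter_addr_0 subn0.
    have : 0 <= \sum_(n <= t < k + n) (survival t x - survival (k + n) x).
      rewrite big_nat; apply: sumr_ge0 => t /andP[_ tk].
      by rewrite subr_ge0; apply: survival_le => //; exact: ltnW.
    rewrite -mulr_natl; lra.
  suff : \sum_(0 <= t < n) survival t x <= E + n%:R * 0 by rewrite mulr0 addr0.
  have c1 : (fun k => E + n%:R * survival (k + n) x) @ \oo --> E + n%:R * 0.
    apply: cvgD; first exact: cvg_cst.
    apply: cvgM; first exact: cvg_cst.
    by rewrite (cvg_shiftn n (fun k => survival k x)).
  rewrite -(cvg_lim (@Rhausdorff R) c1); apply: limr_ge; first exact: cvgP c1.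
  exact: nearW.
(* Survival is nonincreasing, so n * survival n is at most the n-th partial sum, hence at most
   [W]. *)
have r0 : survival ^~ x @ \oo --> (0 : R).
  apply/cvgrPdist_lt => e e0; near=> n; rewrite sub0r normrN ger0_norm ?survival_ge0//.
  have n0 : (0 : R) < n%:R by rewrite ltr0n; near: n; exact: nbhs_infty_gt.
  rewrite -(ltr_pM2l n0).
  apply: (@le_lt_trans _ _ W).
    apply: le_trans (HW n).
    have -> : n%:R * survival n x = \sum_(0 <= t < n) survival n x.
      by rewrite big_const_nat iter_addr_0 subn0 mulr_natl.
    by rewrite !big_nat; apply: ler_sum => t /andP[_ /ltnW]; exact: survival_le.
  rewrite -ltr_pdivrMr//; near: n; exact: nbhs_infty_gtr.
split.
  apply: cvg_lim => //.
  rewrite (_ : (fun k => _) = fun k => (1 - survival k x)%:E); last first.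
    by apply/funext => k; rewrite sum_first_passage.
  apply/fine_cvgP; split; first exact: nearW.
  by rewrite -[1 in X in _ --> X](subr0 1); apply: cvgB => //; exact: cvg_cst.
apply: (@le_lt_trans _ _ W%:E); last exact: ltry.
apply: lime_le; first by apply: is_cvg_nneseries => *; exact: tfp0.
apply: nearW => n; rewrite sum_first_passage_mean// lee_fin.
apply: le_trans (HW n); apply: ler_sum => t _.
by rewrite lerBlDr lerDl survival_ge0.
Unshelve. all: by end_near.
Qed.

(* Foster's criterion: [V] controls the time spent outside [F], and the
   visits to [F] before hitting [x] are dominated by geometric trials. *)
Lemma foster (V : S -> R) (F : pred S) (b e : R) (N : nat) :
  D x -> (forall y, 0 <= V y) -> 0 <= b -> 0 < e -> (0 < N)%N ->
  (forall y, D y -> \esum_(z in [set: S]) (P y z * (V z)%:E) + 1 <=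
     (V y)%:E + b%:E * (F y)%:R%:E)%E ->
  (forall y, D y -> F y -> survival N y <= 1 - e) ->
  positive_recurrent P x.
Proof.
move=> Dx V0 b0 e0 N0 drift hit.
(* The expected number of visits to [F] at times below n, counted until [x] is hit. *)
pose H n y := (\sum_(0 <= t < n) iter t taboo (fun z => (F z)%:R%:E) y)%E.
have H0 n y : (0 <= H n y)%E.
  by apply: sume_ge0 => t _; apply: iter_taboo_ge0 => z; rewrite lee_fin.
have Hcat k n : H (k + n)%N = (H k \+ iter k taboo (H n))%E.
  elim: n k => [|n IH] k.
    rewrite addn0; apply/funext => y /=.
    rewrite (_ : H 0%N = fun y => (0%:E * (cst 1 y))%E); last first.
      by apply/funext => z; rewrite mul0e /H big_nil.
    by rewrite iter_tabooZ//= mul0e adde0.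
  have HS j : H j.+1 = (H j \+ iter j taboo (fun z => (F z)%:R%:E))%E.
    by apply/funext => y; rewrite /H big_nat_recr.
  rewrite addnS HS IH (HS n) iter_tabooD//; last first.
    by move=> z; apply: iter_taboo_ge0 => w; rewrite lee_fin.
  by apply/funext => y /=; rewrite -iterD addeA.
have F01 z : ((F z)%:R%:E <= 1 :> \bar R)%E by rewrite lee_fin; case: (F z).
have HleN n y : D y -> (H n y <= (n%:R)%:E)%E.
  move=> Dy; apply: (@le_trans _ _ (\sum_(0 <= t < n) 1)%E).
    apply: lee_sum => t _; apply: le_trans (iter_taboo1_le1 t Dy).
    by apply: le_iter_taboo.
  by rewrite sumEFin lee_fin big_const_nat iter_addr_0 subn0.
(* The solution of c = N + (1 - e) c: a block of [N] steps contains at most [N] visits, and is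
   survived with probability at most 1 - e. *)
pose c : R := N%:R / e.
have c0 : 0 <= c by rewrite divr_ge0// ltW.
have KC k y : D y -> (iter k taboo (fun=> c%:E) y = (c * survival k y)%:E)%E.
  move=> Dy; rewrite [RHS]EFinM -survivalE//.
  have /(congr1 (@^~ y)) /= <- := @iter_tabooZ k c (fun=> 1%E) c0 (fun=> lee01).
  by congr (iter _ _ _ _); apply/funext => z; rewrite mule1.
(* Strong induction on the horizon: a single step outside [F], where no visit is counted, and [N]
   steps at once from a state of [F]. *)
have Hc n y : D y -> (H n y <= c%:E)%E.
  elim/ltn_ind: n y => n IH y Dy.
  have [Fy|nFy] := boolP (F y); last first.
    case: n IH => [|n] IH; first by rewrite /H big_nil lee_fin.
    rewrite -add1n Hcat /= {1}/H big_nat1 /= (negbTE nFy) add0e.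
    apply: (@le_trans _ _ (iter 1 taboo (fun=> c%:E) y)).
      by apply: le_taboo => // z Dz; exact: IH.
    rewrite KC// lee_fin ler_piMr//.
    by have := iter_taboo1_le1 1 Dy; rewrite survivalE.
  have [nN|Nn] := ltnP n N.
    apply: le_trans (HleN n y Dy) _; rewrite lee_fin /c ler_pdivlMr//.
    have := hit y Dy Fy; have := survival_ge0 N y => s0 s1.
    have e1 : e <= 1 by lra.
    apply: le_trans (_ : N%:R * 1 <= _); last by rewrite mulr1.
    by apply: ler_pM => //; [exact: ltW|rewrite ler_nat ltnW].
  rewrite -(subnKC Nn) Hcat /=.
  apply: (@le_trans _ _ ((N%:R)%:E + (c * survival N y)%:E)%E).
    apply: leeD; first exact: HleN.
    rewrite -KC//; apply: le_iter_taboo => // z Dz; apply: IH => //.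
    by rewrite ltn_subrL N0 (leq_trans N0).
  rewrite -EFinD lee_fin.
  have : c * survival N y <= c * (1 - e) by apply: ler_wpM2l => //; exact: hit.
  have : c * e = N%:R by rewrite /c divfK// gt_eqF.
  lra.
have F0 z : (0 <= (F z)%:R%:E :> \bar R)%E by rewrite lee_fin.
have bE0 : (0 <= b%:E)%E by rewrite lee_fin.
have VE0 z : (0 <= (V z)%:E)%E by rewrite lee_fin.
have drift' y : D y -> (taboo (fun z => (V z)%:E) y + 1 <=
    (V y)%:E + b%:E * (F y)%:R%:E)%E.
  move=> Dy; apply: le_trans (drift y Dy); apply: leeD => //.
  rewrite tabooE; last by move=> z; rewrite lee_fin.
  by rewrite leeDr//; apply: mule_ge0 => //; rewrite lee_fin.
apply/(positive_recurrentP Dx); exists (V x + b * c) => n.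
pose v t := iter t taboo (fun z => (V z)%:E) x.
have v0 t : (0 <= v t)%E by apply: iter_taboo_ge0 => z; rewrite lee_fin.
have step t : (v t.+1 + iter t taboo (fun=> 1) x <=
    v t + b%:E * iter t taboo (fun z => (F z)%:R%:E) x)%E.
  have := @le_iter_taboo t _ _ x drift' Dx.
  rewrite iter_tabooD//; last by move=> z; exact: taboo_ge0.
  rewrite iter_tabooD//; last by move=> z; exact: mule_ge0.
  by rewrite (iter_tabooZ t b0 F0) -iterSr.
(* Telescoped drift: each epoch before hitting [x] costs 1 of [V], and each visit to [F] gives back
   at most [b]. *)
have tel k : (v k + \sum_(0 <= t < k) iter t taboo (fun=> 1) x <=
    (V x)%:E + b%:E * H k x)%E.
  elim: k => [|k IH].
    by rewrite /H !big_nil mule0 !adde0.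
  rewrite big_nat_recr//= addeCA addeC.
  apply: le_trans (leeD (step k) (lexx _)) _.
  rewrite addeAC; apply: le_trans (leeD IH (lexx _)) _.
  rewrite -addeA -ge0_muleDr//; last by apply: iter_taboo_ge0 => w; rewrite lee_fin.
  by rewrite /H big_nat_recr.
rewrite -lee_fin -sumEFin; apply: le_trans (le_trans _ (tel n)) _.
  rewrite (eq_bigr (fun t => iter t taboo (fun=> 1%E) x)); last by move=> t _; rewrite survivalE.
  by rewrite leeDr.
by rewrite EFinD EFinM leeD// lee_wpmul2l// ?lee_fin// Hc.
Qed.

End taboo.

(** * Transition matrix of a policy *)

(** Several activation vectors may lead to the same queues, so [transition] sums over a fibre.
    Choices (s, z') correspond bijectively to a next state together with a vector of its fibre,
    which turns means over next states into means over choices. *)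
Lemma esum_transition (R : realType) (n m : nat) (A : 'M[nat]_(n, m))
    (lambda : 'cV[R]_n) (p : prepolicy R n m) (x : state p)
    (G : state p -> \bar R) :
  (forall i, 0 < lambda i 0) -> (forall i sz, 0 <= rule x.1 x.2 i sz) ->
  (forall y, 0 <= G y)%E ->
  (\esum_(y in [set: state p]) (transition A lambda x y * G y) =
   \sum_(i < n) (lambda i 0 / \sum_j lambda j 0)%:E *
     \esum_(sz in [set: 'cV[nat]_m * internal p])
       ((rule x.1 x.2 i sz)%:E * G (next_queues A x.1 i sz.1, sz.2)))%E.
Proof.
move=> l0 r0 G0.
have w0 i : (0 <= (lambda i 0 / \sum_j lambda j 0)%:E)%E.
  by rewrite lee_fin divr_ge0 ?sumr_ge0// => *; exact: ltW.
have re0 i sz : (0 <= (rule x.1 x.2 i sz)%:E)%E by rewrite lee_fin.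
pose J i (y : state p) := [set s | next_queues A x.1 i s = y.1].
transitivity (\esum_(y in [set: state p]) \sum_(i < n)
    (lambda i 0 / \sum_j lambda j 0)%:E *
      \esum_(s in J i y) ((rule x.1 x.2 i (s, y.2))%:E * G y))%E.
  apply: eq_esum => y _; rewrite /transition ge0_sume_distrl; last first.
    by move=> i _; apply: mule_ge0 => //; apply: esum_ge0.
  apply: eq_bigr => i _; rewrite -muleA; congr (_ * _)%E.
  rewrite muleC -ge0_esumZl//.
  by apply: eq_esum => s _; rewrite muleC.
rewrite esum_sum; last first.
  by move=> y i _ _; apply: mule_ge0 => //; apply: esum_ge0 => s _; exact: mule_ge0.
apply: eq_bigr => i _; rewrite ge0_esumZl//; last first.
  by move=> y; apply: esum_ge0 => s _; exact: mule_ge0.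
congr (_ * _)%E; rewrite esum_esum; last by move=> *; exact: mule_ge0.
pose e (sz : 'cV[nat]_m * internal p) : state p * 'cV[nat]_m :=
  ((next_queues A x.1 i sz.1, sz.2), sz.1).
rewrite (@reindex_esum _ _ _ [set: 'cV[nat]_m * internal p] _ e)//.
  by apply: eq_esum => -[s z] _.
split => [[s z] _ //|[s z] [s' z'] _ _ [_ -> ->]//|].
by move=> [[y z] s] [_ /= yE]; exists (s, z) => //; rewrite /e /= yE.
Qed.

Section policy_transition.
Variables (R : realType) (n m : nat) (A : 'M[nat]_(n, m)) (lambda : 'cV[R]_n).
Hypotheses (n_gt0 : (0 < n)%N) (lambda_gt0 : forall i, 0 < lambda i 0).

Lemma arrival_gt0 i : 0 < lambda i 0 / \sum_j lambda j 0.
Proof.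
rewrite divr_gt0// (bigD1 i)//= ltr_pwDl// sumr_ge0// => j _; exact: ltW.
Qed.

Lemma sum_arrival : \sum_(i < n) (lambda i 0 / \sum_j lambda j 0) = 1.
Proof.
rewrite -mulr_suml mulfV// gt_eqF// (bigD1 (Ordinal n_gt0))//= ltr_pwDl//.
by apply: sumr_ge0 => j _; exact: ltW.
Qed.

Variable p : prepolicy R n m.
Hypothesis p_policy : is_policy A p.

Lemma transition_ge0 (x y : state p) : (0 <= transition A lambda x y)%E.
Proof.
have [r0 _ _ _] := p_policy.
apply: sume_ge0 => i _; apply: mule_ge0; first by rewrite lee_fin ltW// arrival_gt0.
by apply: esum_ge0 => s _; rewrite lee_fin.
Qed.

Lemma transition_stochastic (x : state p) :
  (\esum_(y in [set: state p]) transition A lambda x y = 1)%E.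
Proof.
have [r0 r1 _ _] := p_policy.
transitivity (\esum_(y in [set: state p]) (transition A lambda x y * 1))%E.
  by apply: eq_esum => y _; rewrite mule1.
rewrite (@esum_transition _ _ _ _ _ _ _ (fun=> 1%E))//.
under eq_bigr do under eq_esum do rewrite mule1.
by under eq_bigr do rewrite r1 mule1; rewrite sumEFin sum_arrival.
Qed.

Lemma transition_gt0 (x y : state p) : (0 < transition A lambda x y)%E ->
  exists i s, 0 < rule x.1 x.2 i (s, y.2) /\ next_queues A x.1 i s = y.1.
Proof.
have [r0 _ _ _] := p_policy.
apply: contraPP => H; apply/negP; rewrite -leNgt /transition big1// => i _.
rewrite esum1 ?mule0// => s sy; congr EFin; apply/eqP; move: (r0 x.1 x.2 i (s, y.2)).
by rewrite le_eqVlt => /orP[/eqP <-//|sp]; exfalso; apply: H; exists i, s.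
Qed.

Lemma reachable_transition (x y : state p) : reachable A x.1 x.2 ->
  (0 < transition A lambda x y)%E -> reachable A y.1 y.2.
Proof.
by move=> xr /transition_gt0[i [s [sp <-]]]; exact: reachable_step sp.
Qed.

End policy_transition.

(** * Farkas' lemma and the interior of the cone *)

Definition dot (R : realType) (n : nat) (u v : 'cV[R]_n) : R :=
  \sum_i u i 0 * v i 0.

Section dot.
Variables (R : realType) (n : nat).
Implicit Types u v w : 'cV[R]_n.

Lemma dotC u v : dot u v = dot v u.
Proof. by apply: eq_bigr => i _; rewrite mulrC. Qed.

Lemma dotDl u v w : dot (u + v) w = dot u w + dot v w.
Proof. by rewrite -big_split; apply: eq_bigr => i _; rewrite mxE mulrDl. Qed.

Lemma dotZl c u w : dot (c *: u) w = c * dot u w.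
Proof. by rewrite /dot mulr_sumr; apply: eq_bigr => i _; rewrite mxE mulrA. Qed.

Lemma dotNl u w : dot (- u) w = - dot u w.
Proof. by rewrite -scaleN1r dotZl mulN1r. Qed.

Lemma dotBl u v w : dot (u - v) w = dot u w - dot v w.
Proof. by rewrite dotDl dotNl. Qed.

Lemma dotBr u v w : dot w (u - v) = dot w u - dot w v.
Proof. by rewrite dotC dotBl !(dotC w). Qed.

Lemma dotZr c u w : dot w (c *: u) = c * dot w u.
Proof. by rewrite dotC dotZl dotC. Qed.

Lemma dot_gt0 u : u != 0 -> 0 < dot u u.
Proof.
move=> u0; have [i ui] : exists i, u i 0 != 0.
  apply/not_existsP => H; case/negP: u0; apply/eqP/matrixP => i j.
  by rewrite ord1 mxE; apply/eqP; have /negP := H i; rewrite negbK.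
rewrite /dot (bigD1 i)//= ltr_pwDl// -?expr2 ?exprn_even_gt0//.
by apply: sumr_ge0 => j _; rewrite -expr2 sqr_ge0.
Qed.

End dot.

(* Induction on the number of generators, eliminating [a ord0] (Bartl). *)
Lemma farkas (R : realType) (n m : nat) (a : 'I_m -> 'cV[R]_n) (b : 'cV[R]_n) :
  (exists mu : 'I_m -> R, (forall k, 0 <= mu k) /\ b = \sum_k mu k *: a k) \/
  (exists x, (forall k, dot (a k) x <= 0) /\ 0 < dot b x).
Proof.
elim: m a b => [|m IH] a b.
  have [->|b0] := eqVneq b 0.
    by left; exists (fun=> 0); split => //; rewrite big_ord0.
  by right; exists b; split; [case|exact: dot_gt0].
have [[mu [mu0 ->]]|[z [az bz]]] := IH (a \o lift ord0) b.
  left; exists (fun k => if unlift ord0 k is Some k' then mu k' else 0); split.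
    by move=> k; case: unliftP.
  rewrite big_ord_recl unlift_none scale0r add0r; apply: eq_bigr => k _.
  by rewrite liftK.
have [a0z|a0z] := leP (dot (a ord0) z) 0.
  right; exists z; split => // k; have [k' ->|->//] := unliftP ord0 k.
  exact: az.
pose y := (dot (a ord0) z)^-1 *: z.
have ay k : dot (a (lift ord0 k)) y <= 0.
  by rewrite dotZr pmulr_rle0 ?invr_gt0//; exact: az.
have by0 : 0 < dot b y by rewrite dotZr mulr_gt0// invr_gt0.
have a0y : dot (a ord0) y = 1 by rewrite dotZr mulVf// gt_eqF.
(* The projection along [a ord0] onto the orthogonal of [y]; the induction hypothesis is used again
   on the projected generators. *)
pose pr u : 'cV[R]_n := u - dot u y *: a ord0.
have [[mu [mu0 bE]]|[x [ax bx]]] := IH (pr \o a \o lift ord0) (pr b).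
  (* Pairing with [y] dictates the coefficient of [a ord0]; it is nonnegative because [b] pairs
     positively with [y] and the other generators do not. *)
  left; exists (fun k => if unlift ord0 k is Some k' then mu k' else
    dot b y - \sum_k mu k * dot (a (lift ord0 k)) y); split.
    move=> k; case: unliftP => // _; rewrite subr_ge0.
    apply: le_trans (ltW by0); apply: sumr_le0 => k' _.
    by rewrite mulr_ge0_le0.
  rewrite big_ord_recl unlift_none (eq_bigr (fun k => mu k *: a (lift ord0 k))); last first.
    by move=> k _; rewrite liftK.
  rewrite -[LHS](subrK (dot b y *: a ord0)) -/(pr b) bE.
  rewrite (_ : \sum_k _ = \sum_k mu k *: a (lift ord0 k) -
      (\sum_k mu k * dot (a (lift ord0 k)) y) *: a ord0).
    by rewrite scalerBl [LHS]addrC addrA [RHS]addrAC.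
  rewrite scaler_suml -sumrB; apply: eq_bigr => k _.
  by rewrite /= /pr scalerBr scalerA.
(* The adjoint of [pr] applied to [x]; it is orthogonal to [a ord0]. *)
right; exists (x - dot (a ord0) x *: y).
have E u : dot u (x - dot (a ord0) x *: y) = dot (pr u) x.
  by rewrite /pr dotBl dotBr !dotZr dotZl mulrC.
split; last by rewrite E.
move=> k; have [k' ->|->] := unliftP ord0 k; first by rewrite E; exact: ax.
by rewrite dotBr dotZr a0y mulr1 subrr.
Qed.

Section cone.
Variables (R : realType) (n m : nat) (A : 'M[nat]_(n, m)) (lambda : 'cV[R]_n).

Definition interior_point : Prop :=
  surjective_mx R A /\
  exists mu : 'cV[R]_m, (forall k, 0 < mu k 0) /\ real_mx R A *m mu = lambda.

Lemma mulmx_colE (mu : 'cV[R]_m) :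
  real_mx R A *m mu = \sum_k mu k 0 *: col k (real_mx R A).
Proof.
apply/matrixP => i j; rewrite ord1 !mxE summxE; apply: eq_bigr => k _.
by rewrite !mxE mulrC.
Qed.

(** Adjoin -lambda to the columns. If their cone is the whole space, representing suitable vectors
    gives surjectivity and a positive mu; otherwise a vector outside it is separated from it. *)
Lemma interior_point_or_separated : interior_point \/
  exists v : 'cV[R]_n, [/\ v != 0, forall k, dot (col k (real_mx R A)) v <= 0 &
    0 <= dot lambda v].
Proof.
pose a k := if unlift ord0 k is Some k' then col k' (real_mx R A) else - lambda.
have [H|/existsNP[b Hb]] := pselect (forall b, exists mu : 'I_m.+1 -> R,
    (forall k, 0 <= mu k) /\ b = \sum_k mu k *: a k); last first.
  have [//|[v [av bv]]] := farkas a b; right; exists v; split.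
  - by apply: contraTneq bv => ->; rewrite /dot big1 ?ltxx// => i _; rewrite mxE mulr0.
  - by move=> k; have := av (lift ord0 k); rewrite /a liftK.
  - by have := av ord0; rewrite /a unlift_none dotNl oppr_le0.
have {}H b : exists s (nu : 'cV[R]_m), [/\ 0 <= s, forall k, 0 <= nu k 0 &
    b = real_mx R A *m nu - s *: lambda].
  have [mu [mu0 ->]] := H b.
  exists (mu ord0), (\col_k mu (lift ord0 k)); split => //.
    by move=> k; rewrite mxE.
  rewrite big_ord_recl {1}/a unlift_none scalerN addrC mulmx_colE; congr (_ - _).
  by apply: eq_bigr => k _; rewrite mxE /a liftK.
have solve s (w : 'cV[R]_m) : 0 <= s -> (1 + s) *: lambda = real_mx R A *m w ->
    lambda = real_mx R A *m ((1 + s)^-1 *: w).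
  move=> s0 E; rewrite -scalemxAr -E scalerA mulVf ?scale1r// gt_eqF//.
  by rewrite ltr_pwDl.
left; split.
  have [s0 [nu0 [s00 _ E0]]] := H lambda.
  have /(solve _ _ s00) {}E0 : (1 + s0) *: lambda = real_mx R A *m nu0.
    by rewrite scalerDl scale1r {1}E0 subrK.
  move=> y; have [s [nu [_ _ ->]]] := H y.
  exists (nu - s *: ((1 + s0)^-1 *: nu0)).
  by rewrite mulmxBr -scalemxAr -E0.
(* Subtracting A 1 beforehand allows 1 to be added to every coefficient, which makes them
   positive. *)
have [s [nu [s0 nu0 E]]] := H (lambda - real_mx R A *m const_mx 1).
exists ((1 + s)^-1 *: (nu + const_mx 1)); split.
  move=> k; have nuk := nu0 k; rewrite !mxE mulr_gt0 ?invr_gt0//; lra.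
rewrite -solve// mulmxDr scalerDl scale1r -[real_mx R A *m nu](subrK (s *: lambda)).
by rewrite -E addrAC subrK.
Qed.

Lemma interior_pointP : interior_point <-> (cone A)° lambda.
Proof.
split=> [[surj [mu [mu0 <-]]]|]; last first.
  rewrite /interior /= => /nbhs_ballP[e /= e0 He].
  (* In every direction y the cone contains a point beyond [lambda]. Comparing y with 0 gives
     surjectivity; y = - A 1 gives positive coefficients. *)
  have Hy (y : 'cV[R]_n) : exists2 d, 0 < d & cone A (lambda + d *: y).
    pose Y := 1 + \sum_i `|y i 0|.
    have Y0 : 0 < Y by rewrite ltr_pwDl// sumr_ge0.
    exists (e / Y); first by rewrite divr_gt0.
    apply: He; split => // i j; rewrite ord1 /ball /= !mxE opprD addrA subrr sub0r normrN.
    rewrite normrM (gtr0_norm (divr_gt0 e0 Y0)) mulrAC ltr_pdivrMr//.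
    rewrite ltr_pM2l// /Y (bigD1 i)//= addrCA ltrDl ltr_pwDl// sumr_ge0//.
  have [d0 d00 [nu0 _ E0]] := Hy 0.
  rewrite scaler0 addr0 in E0.
  split=> [y|].
    have [d d1 [nu _ E]] := Hy y.
    exists (d^-1 *: (nu - nu0)).
    by rewrite -scalemxAr mulmxBr E E0 addrAC subrr add0r scalerA mulVf ?scale1r// gt_eqF.
  have [d d1 [nu nu_ge0 E]] := Hy (- (real_mx R A *m const_mx 1)).
  exists (nu + d *: const_mx 1); split.
    by move=> k; rewrite !mxE mulr1 ltr_wpDl//; exact: nu_ge0.
  by rewrite mulmxDr E -scalemxAr scalerN subrK.
have /choice[y Hy] : forall j : 'I_n, exists y : 'cV[R]_m,
    real_mx R A *m y = delta_mx j 0.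
  by move=> j; exact: surj.
pose Y k := 1 + \sum_j `|y j k 0|.
have Y0 k : 0 < Y k by rewrite ltr_pwDl// sumr_ge0.
(* With radius 1/Z the correction to the k-th coefficient is at most Y_k / Z, which does not exceed
   mu_k. *)
pose Z := 1 + \sum_k Y k / mu k 0.
have Z0 : 0 < Z by rewrite ltr_pwDl// sumr_ge0// => k _; rewrite divr_ge0 ?ltW.
rewrite /interior /=; apply/nbhs_ballP; exists Z^-1 => /=; first by rewrite invr_gt0.
move=> z zb; pose d := z - real_mx R A *m mu.
have dZ j : `|d j 0| <= Z^-1.
  by have [_ /(_ j 0)] := zb; rewrite /ball /= /d => zj; rewrite 2!mxE distrC ltW.
exists (mu + \sum_j d j 0 *: y j); last first.
  rewrite mulmxDr mulmx_sumr.
  under eq_bigr => j _ do rewrite -scalemxAr Hy.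
  rewrite (_ : \sum_j _ = d); first by rewrite /d addrC subrK.
  apply/matrixP => i j; rewrite ord1 summxE (bigD1 i)//= big1 ?addr0.
    by rewrite !mxE !eqxx mulr1.
  by move=> k ki; rewrite !mxE eq_sym (negbTE ki) mulr0.
move=> k /=; rewrite mxE summxE.
have : `|\sum_j (d j 0 *: y j) k 0| <= Z^-1 * Y k.
  apply: le_trans (ler_norm_sum _ _ _) _.
  rewrite /Y mulrDr mulr_sumr -[leLHS]add0r; apply: lerD.
    by rewrite mulr1 invr_ge0 ltW.
  by apply: ler_sum => j _; rewrite mxE normrM ler_wpM2r.
have : Z^-1 * Y k <= mu k 0.
  rewrite mulrC ler_pdivrMr// -ler_pdivrMl// mulrC /Z (bigD1 k)//= addrCA lerDl.
  by rewrite addr_ge0// sumr_ge0// => j _; rewrite divr_ge0 ?ltW.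
by move=> H1 /(le_trans)/(_ H1); rewrite ler_norml => /andP[H2 _]; rewrite -lerBlDl sub0r.
Qed.

End cone.

(** * Necessity of the interior condition *)

Section test_function.
Variable R : realType.
Implicit Types M y a : R.

(* The derivative [test_der M] is a tent: it vanishes outside [-M, 3M], has
   slope 2 on [-M, M] and slope -2 on [M, 3M]. *)
Definition sqpos y := (Num.max y 0) ^+ 2.
Definition test_fun M y := sqpos (y + M) - 2 * sqpos (y - M) + sqpos (y - 3 * M).
Definition test_der M y := 2 * (Num.max (y + M) 0 - 2 * Num.max (y - M) 0 +
  Num.max (y - 3 * M) 0).

Lemma sqpos_taylor y a :
  0 <= sqpos (y + a) - sqpos y - 2 * Num.max y 0 * a <= a ^+ 2.
Proof.
rewrite /sqpos; case: (leP y 0) => y0; case: (leP (y + a) 0) => ya0;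
  apply/andP; split; nra.
Qed.

Lemma test_fun_ge0 M y : 0 < M -> 0 <= test_fun M y.
Proof.
rewrite /test_fun /sqpos => M0; case: (leP (y + M) 0) => h1;
  case: (leP (y - M) 0) => h2; case: (leP (y - 3 * M) 0) => h3; nra.
Qed.

Lemma test_fun_le M y : 0 < M -> test_fun M y <= 8 * M ^+ 2.
Proof.
rewrite /test_fun /sqpos => M0; case: (leP (y + M) 0) => h1;
  case: (leP (y - M) 0) => h2; case: (leP (y - 3 * M) 0) => h3; nra.
Qed.

Lemma test_der_ge0 M y : 0 < M -> 0 <= test_der M y.
Proof.
rewrite /test_der => M0; case: (leP (y + M) 0) => h1;
  case: (leP (y - M) 0) => h2; case: (leP (y - 3 * M) 0) => h3; lra.
Qed.

(** The constant 2 comes from the middle square, the only one with a negative coefficient; each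
    remainder of [sqpos] lies between 0 and a^2. *)
Lemma test_fun_taylor M y a :
  test_fun M y + test_der M y * a - 2 * a ^+ 2 <= test_fun M (y + a).
Proof.
rewrite /test_fun /test_der !(addrAC y a).
have /andP[h1 _] := sqpos_taylor (y + M) a.
have /andP[_ h2] := sqpos_taylor (y - M) a.
have /andP[h3 _] := sqpos_taylor (y - 3 * M) a.
lra.
Qed.

Lemma test_fun_near M y a : `|y| <= M -> `|y + a| <= M ->
  test_fun M (y + a) = test_fun M y + test_der M y * a + a ^+ 2.
Proof.
rewrite !ler_norml => /andP[h1 h2] /andP[h3 h4].
rewrite /test_fun /test_der /sqpos.
rewrite (max_l (_ : 0 <= y + a + M)) ?(max_l (_ : 0 <= y + M)); [|lra|lra].
rewrite !(max_r (_ : y + a - M <= 0)) ?(max_r (_ : y - M <= 0)); [|lra|lra].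
rewrite !(max_r (_ : y + a - 3 * M <= 0)) ?(max_r (_ : y - 3 * M <= 0)); [|lra|lra].
ring.
Qed.

End test_function.

Section necessity.
Variables (R : realType) (n m : nat) (A : 'M[nat]_(n, m)) (lambda : 'cV[R]_n).
Hypotheses (n_gt0 : (0 < n)%N) (lambda_gt0 : forall i, 0 < lambda i 0).
Variable p : prepolicy R n m.
Hypothesis p_policy : is_policy A p.
Variable v : 'cV[R]_n.
Hypothesis v_neq0 : v != 0.
Hypothesis v_edge : forall k, dot (col k (real_mx R A)) v <= 0.
Hypothesis v_rate : 0 <= dot lambda v.

Let P := transition A lambda (p := p).
Let rate i := lambda i 0 / \sum_j lambda j 0.

Definition height (x : state p) : R := \sum_j v j 0 * (x.1 j 0)%:R.

Lemma height_step : exists2 b : R, 0 < b & forall (x : state p) i s z',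
  reachable A x.1 x.2 -> 0 < rule x.1 x.2 i (s, z') ->
  exists2 a, height (next_queues A x.1 i s, z') = height x + a &
    v i 0 <= a /\ `|a| <= b.
Proof.
have [r0 r1 feas [K HK]] := p_policy.
pose Y := \sum_k `|dot (col k (real_mx R A)) v|.
pose b := 1 + \sum_i `|v i 0| + K%:R * Y.
have Y0 : 0 <= Y by exact: sumr_ge0.
have v0 : 0 <= \sum_i `|v i 0| by exact: sumr_ge0.
have KY0 : 0 <= K%:R * Y by exact: mulr_ge0.
exists b; first by rewrite /b; lra.
move=> x i s z' xr sp; have le := feas _ _ _ _ _ xr sp.
pose d := \sum_k (s k 0)%:R * dot (col k (real_mx R A)) v.
have d0 : d <= 0 by apply: sumr_le0 => k _; rewrite mulr_ge0_le0.
have dK : - d <= K%:R * Y.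
  rewrite -sumrN mulr_sumr; apply: ler_sum => k _.
  rewrite -mulrN ler_pM//.
  - by rewrite oppr_ge0.
  - rewrite ler_nat; apply: leq_trans (HK _ _ _ _ _ xr sp).
    by rewrite /norm1 (bigD1 k)//= leq_addr.
  - by rewrite -normrN ler_norm.
exists (v i 0 - d).
  rewrite /height /=.
  have E j : v j 0 * ((next_queues A x.1 i s) j 0)%:R =
      v j 0 * (x.1 j 0)%:R + (v j 0 * (j == i)%:R - v j 0 * ((A *m s) j 0)%:R).
    have := le j; rewrite /next_queues /subv mxE => lej.
    by rewrite natrB// !mxE eqxx andbT natrD; ring.
  rewrite (eq_bigr _ (fun j _ => E j)) big_split sumrB; congr (_ + (_ - _)).
    by rewrite (bigD1 i)//= eqxx mulr1 big1 ?addr0// => j /negbTE ->; rewrite mulr0.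
  rewrite /d; under [RHS]eq_bigr do rewrite /dot mulr_sumr.
  rewrite exchange_big; apply: eq_bigr => j _; rewrite mxE natr_sum mulr_sumr.
  by apply: eq_bigr => k _; rewrite natrM !mxE; ring.
split; first by lra.
have vi : `|v i 0| <= \sum_i `|v i 0| by rewrite (bigD1 i)//= lerDl sumr_ge0.
apply: le_trans (ler_normB _ _) _; rewrite (ler0_norm d0) /b; lra.
Qed.

(* If [g] is the test function at scale [M], the expected increment of
   [g (height x)] is bounded below uniformly in [M], and it is at least a
   positive constant where [g] is quadratic. Summing over one excursion from
   the empty state, whose mean length is finite, gives a contradiction. *)
Lemma separated_not_recurrent : ~ positive_recurrent P (init_state p).
Proof.
have [r0 r1 feas _] := p_policy.
have P0 : forall y z, (0 <= P y z)%E by exact: transition_ge0.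
have Pst y : reachable A y.1 y.2 -> (\esum_(z in [set: state p]) P y z = 1)%E.
  by move=> _; exact: transition_stochastic.
pose D := [set y : state p | reachable A y.1 y.2].
have Pcl y z : D y -> (0 < P y z)%E -> D z by exact: reachable_transition.
have Dx : D (init_state p) by exact: reachable_init.
move=> /(positive_recurrentP P0 Pcl Pst Dx)[W HW].
set x := init_state p in Dx HW *.
pose r t := survival P x t x.
have r_ge0 t : 0 <= r t by exact: (survival_ge0 x P0).
have r_le t s : (s <= t)%N -> r t <= r s by exact: (survival_le x P0 Pcl Pst Dx).
have r_0 : r 0%N = 1 by [].
have [b b0 Hb] := height_step.
(* [C] bounds the curvature loss of one step. [delta] is the mean gain in the quadratic zone, where
   an increment a >= v_i has a^2 >= max(v_i, 0)^2. *)
pose C := 2 * b ^+ 2.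
pose delta := \sum_i rate i * (Num.max (v i 0) 0) ^+ 2.
have rate_gt0 i : 0 < rate i by exact: arrival_gt0.
have rate1 : \sum_i rate i = 1 by exact: sum_arrival.
have rate_v : 0 <= \sum_i rate i * v i 0.
  rewrite (_ : \sum_i _ = (\sum_j lambda j 0)^-1 * dot lambda v).
    by rewrite mulr_ge0// invr_ge0 sumr_ge0// => j _; exact: ltW.
  by rewrite /dot mulr_sumr; apply: eq_bigr => i _; rewrite /rate; ring.
have avg (a d : R) (e : 'I_n -> R) : \sum_i rate i * (a + d * v i 0 + e i) =
    a + d * (\sum_i rate i * v i 0) + \sum_i rate i * e i.
  under eq_bigr do rewrite !mulrDr.
  rewrite !big_split /= -mulr_suml rate1 mul1r mulr_sumr.
  by congr (_ + _ + _); apply: eq_bigr => i _; rewrite mulrCA.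
have delta0 : 0 < delta.
  (* Without a positive entry, <v, lambda> >= 0 and positive rates would force v = 0. *)
  have [i vi] : exists i, 0 < v i 0.
    apply/not_existsP => H.
    have v0 i : v i 0 <= 0 by rewrite leNgt; exact/negP.
    have : dot lambda v = 0.
      apply/eqP; rewrite eq_le v_rate andbT; apply: sumr_le0 => i _.
      by rewrite mulr_ge0_le0// ltW.
    move/eqP; rewrite /dot -oppr_eq0 -sumrN psumr_eq0; last first.
      by move=> i _; rewrite oppr_ge0 mulr_ge0_le0// ltW.
    move=> /allP H0; case/negP: v_neq0; apply/eqP/matrixP => i j.
    have := H0 i (mem_index_enum _); rewrite ord1 mxE oppr_eq0 mulf_eq0 gt_eqF//=.
    by move/eqP.
  rewrite /delta (bigD1 i)//= ltr_pwDl//.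
    by rewrite mulr_gt0// max_l ?exprn_gt0// ltW.
  by apply: sumr_ge0 => j _; rewrite mulr_ge0 ?sqr_ge0// ltW.
have C0 : 0 < C by rewrite mulr_gt0// exprn_gt0.
(* Beyond [T] the total curvature loss is at most delta/3. Before [T], steps of size at most [b]
   from height 0 stay in the quadratic zone of scale M = (T + 1) b. *)
have [T T0 HT] : exists2 T, (0 < T)%N &
    forall N, (T <= N)%N -> C * \sum_(T <= t < N) r t <= delta / 3.
  pose E := [set s | exists N, s = \sum_(0 <= t < N) r t].
  have supE : has_sup E.
    split; first by exists (\sum_(0 <= t < 0) r t), 0%N.
    by exists W => _ [N ->]; exact: HW.
  have eta0 : 0 < delta / 3 / C by rewrite !divr_gt0.
  have [_ [T0 ->] HT0] := sup_adherent eta0 supE.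
  exists T0.+1 => // N TN.
  rewrite -ler_pdivlMl// mulrC.
  have : \sum_(0 <= t < N) r t <= sup E by apply: (ub_le_sup supE.2); exists N.
  rewrite (@big_cat_nat _ _ _ T0.+1)//= big_nat_recr//=.
  have := r_ge0 T0; lra.
pose M := T.+1%:R * b.
have M0 : 0 < M by rewrite mulr_gt0.
pose L := 8 * M ^+ 2.
have L0 : 0 < L by rewrite mulr_gt0// exprn_gt0.
pose G (y : state p) := test_fun M (height y).
have G0 y : 0 <= G y by exact: test_fun_ge0.
have GL y : G y <= L by exact: test_fun_le.
pose near_ (y : state p) : bool := `|height y| <= M - b.
have ruleLB (y : state p) i (c : R) : (forall s z', 0 < rule y.1 y.2 i (s, z') ->
    c <= G (next_queues A y.1 i s, z')) ->
  (c%:E <= \esum_(sz in [set: 'cV[nat]_m * internal p])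
    ((rule y.1 y.2 i sz)%:E * (G (next_queues A y.1 i sz.1, sz.2))%:E))%E.
  move=> Hc; have [c0|c0] := ltP c 0.
    apply: (@le_trans _ _ 0%E); first by rewrite lee_fin ltW.
    by apply: esum_ge0 => sz _; apply: mule_ge0; rewrite lee_fin.
  rewrite -[c%:E]mule1 -(r1 y.1 y.2 i) -ge0_esumZl//; last by move=> sz; rewrite lee_fin.
  apply: le_esum => -[s z'] _; rewrite -!EFinM lee_fin mulrC.
  have := r0 y.1 y.2 i (s, z'); rewrite le_eqVlt => /orP[/eqP <-|sp].
    by rewrite !mul0r.
  by rewrite ler_pM2l//; exact: Hc.
(* The linear term is dropped: [test_der] and the mean of v_i under the arrival law are both
   nonnegative. *)
have drift y : D y -> ((G y)%:E + (C + delta)%:E * (near_ y)%:R%:E <=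
    \esum_(z in [set: state p]) (P y z * (G z)%:E) + C%:E)%E.
  move=> Dy; pose c i := G y + test_der M (height y) * v i 0 +
    if near_ y then (Num.max (v i 0) 0) ^+ 2 else - C.
  have der0 : 0 <= test_der M (height y) by exact: test_der_ge0.
  rewrite (@esum_transition _ _ _ _ _ _ _ (fun y => (G y)%:E))//.
  apply: (@le_trans _ _ (\sum_i (rate i)%:E * (c i)%:E + C%:E)%E); last first.
    apply: leeD => //; apply: lee_sum => i _; apply: lee_wpmul2l.
      by rewrite lee_fin ltW.
    apply: ruleLB => s z' sp; have [a aE [va ab]] := Hb _ _ _ _ Dy sp.
    rewrite /G aE /c -/(G y).
    have dva : test_der M (height y) * v i 0 <= test_der M (height y) * a.
      by rewrite ler_wpM2l.
    have aa : a ^+ 2 <= b ^+ 2 by rewrite -real_normK ?num_real// lerXn2r// nnegrE ltW.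
    case: ifPn => [ny|_]; last first.
      have := test_fun_taylor M (height y) a; rewrite -/(G y) /C; lra.
    rewrite test_fun_near; last 2 first.
    - by apply: le_trans ny _; rewrite gerBl ltW.
    - apply: le_trans (ler_normD _ _) _; move: ny; rewrite /near_; lra.
    rewrite -/(G y) lerD//; first by rewrite lerD.
    by case: (leP (v i 0) 0) => vi0; [rewrite expr0n sqr_ge0|rewrite lerXn2r// nnegrE; lra].
  rewrite (_ : (\sum_i _)%E = (\sum_i rate i * c i)%:E); last first.
    by rewrite -sumEFin; apply: eq_bigr => i _; rewrite EFinM.
  rewrite -EFinM -!EFinD lee_fin /c.
  rewrite avg.
  have : 0 <= test_der M (height y) * \sum_i rate i * v i 0 by rewrite mulr_ge0.
  case: (near_ y) => /=; first by rewrite mulr1 -/delta; lra.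
  by rewrite mulr0 -mulr_suml rate1 mul1r; lra.
have GE0 y : (0 <= (G y)%:E)%E by rewrite lee_fin.
have nE0 y : (0 <= (near_ y)%:R%:E :> \bar R)%E by rewrite lee_fin.
have CE0 : 0 <= C + delta by rewrite addr_ge0// ltW.
pose g t := fine (iter t (taboo P x) (fun y => (G y)%:E) x).
have gE t : iter t (taboo P x) (fun y => (G y)%:E) x = (g t)%:E /\ g t <= L * r t.
  have le : (iter t (taboo P x) (fun y => (G y)%:E) x <= (L * r t)%:E)%E.
    rewrite EFinM -(survivalE x P0 Pcl Pst)//.
    have := @iter_tabooZ _ _ P x P0 t L (fun=> 1%E) (ltW L0) (fun=> lee01).
    move=> /(congr1 (@^~ x)) /= <-; apply: (le_iter_taboo x P0 Pcl) => // z _.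
    by rewrite mule1 lee_fin.
  have fin : (iter t (taboo P x) (fun y => (G y)%:E) x)%E \is a fin_num.
    rewrite ge0_fin_numE ?(iter_taboo_ge0 x P0)//.
    by apply: le_lt_trans le _; rewrite ltry.
  by rewrite /g fineK//; split => //; rewrite -lee_fin fineK.
pose q t := fine (iter t (taboo P x) (fun y => (near_ y)%:R%:E) x).
have qE t : iter t (taboo P x) (fun y => (near_ y)%:R%:E) x = (q t)%:E.
  rewrite /q fineK// ge0_fin_numE ?(iter_taboo_ge0 x P0)//.
  apply: (@le_lt_trans _ _ 1%E); last exact: ltry.
  apply: le_trans (iter_taboo1_le1 x P0 Pcl Pst t Dx).
  by apply: (le_iter_taboo x P0 Pcl) => // z _; rewrite lee_fin; case: (near_ z).
have q0 t : 0 <= q t by rewrite -lee_fin -qE (iter_taboo_ge0 x P0).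
have nearE t y : D y -> `|height y| + t%:R * b <= M - b ->
    (iter t (taboo P x) (fun=> 1) y <=
     iter t (taboo P x) (fun y => (near_ y)%:R%:E) y)%E.
  elim: t y => [|t IH] y Dy /=.
    by rewrite mul0r addr0 /near_ => ->.
  move=> Hy; apply: (le_taboo_succ x P0) => z Pz; apply: IH; first exact: Pcl Pz.
  have [i [s [sp sz]]] := transition_gt0 p_policy Pz.
  have [a + [_ ab]] := Hb _ _ _ _ Dy sp.
  rewrite sz => zE; have -> : height z = height y + a by rewrite -zE; case: (z).
  have := ler_normD (height y) a; move: Hy; rewrite -natr1 mulrDl mul1r; lra.
have rq t : (t < T)%N -> r t <= q t.
  move=> tT; rewrite -lee_fin -qE /r -(survivalE x P0 Pcl Pst)//; apply: nearE => //.
  rewrite /height big1; last by move=> j _; rewrite mxE mulr0.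
  rewrite normr0 add0r /M -natr1 mulrDl mul1r addrK ler_wpM2r ?(ltW b0)//.
  by rewrite ler_nat ltnW.
(* The term g_0 (r_t - r_{t+1}) accounts for the excursions that end at this step. *)
have step t : g t + (C + delta) * q t <=
    g t.+1 + g 0%N * (r t - r t.+1) + C * r t.
  have H y : D y -> ((G y)%:E + (C + delta)%:E * (near_ y)%:R%:E <=
      taboo P x (fun y => (G y)%:E) y + (G x)%:E * P y x + C%:E * 1)%E.
    move=> Dy; have := drift y Dy.
    by rewrite (tabooE x P0) // mule1 addeAC [(P y x * _)%E]muleC addeC addeA addeAC.
  have := le_iter_taboo x P0 Pcl t H Dx.
  have GxE0 : (0 <= (G x)%:E)%E by [].
  have CE : (0 <= (C + delta)%:E)%E by rewrite lee_fin.
  have C1 : (0 <= C%:E)%E by rewrite lee_fin ltW.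
  rewrite (@iter_tabooD _ _ P x P0 t (fun y => (G y)%:E)
    (fun y => ((C + delta)%:E * (near_ y)%:R%:E)%E))//; last first.
    by move=> z; exact: mule_ge0.
  rewrite (@iter_tabooD _ _ P x P0 t
    (fun y => taboo P x (fun y => (G y)%:E) y + (G x)%:E * P y x)%E
    (fun y => C%:E * 1)%E)//; last 2 first.
  - by move=> z; apply: adde_ge0; [exact: (taboo_ge0 x P0)|exact: mule_ge0].
  - by move=> z; exact: mule_ge0.
  rewrite (@iter_tabooD _ _ P x P0 t (taboo P x (fun y => (G y)%:E))
    (fun y => (G x)%:E * P y x)%E)//; last 2 first.
  - by move=> z; exact: (taboo_ge0 x P0).
  - by move=> z; exact: mule_ge0.
  rewrite -iterSr (@iter_tabooZ _ _ P x P0 t (C + delta) (fun y => (near_ y)%:R%:E))//.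
  rewrite (@iter_tabooZ _ _ P x P0 t (G x) (P^~ x))//.
  rewrite (iter_tabooZ x P0 t (ltW C0) (g := fun=> 1%E))//.
  rewrite -first_passageE (first_passage_survival x P0 Pcl Pst)//.
  rewrite (survivalE x P0 Pcl Pst)// qE (gE t).1 (gE t.+1).1.
  by rewrite -!EFinM -!EFinD lee_fin.
have tel N : g 0%N + (C + delta) * (\sum_(0 <= t < N) q t) <=
    g N + g 0%N * (1 - r N) + C * \sum_(0 <= t < N) r t.
  elim: N => [|N IH]; first by rewrite !big_nil r_0 subrr !mulr0 !addr0.
  rewrite !big_nat_recr//= !mulrDr.
  have := step N; move: IH; rewrite !mulrBr !mulrDl; lra.
have [N TN rN] : exists2 N, (T <= N)%N & L * r N < delta / 3.
  have W0 : 0 <= W by apply: le_trans (HW 0%N); rewrite big_nil.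
  pose N := maxn T (Num.truncn (3 * L * W / delta)).+1.
  have N0 : (0 : R) < N%:R by rewrite ltr0n leq_max T0.
  exists N; first exact: leq_maxl.
  have NW : 3 * L * W / delta < N%:R.
    apply: lt_le_trans (truncnS_gt _) _; by rewrite ler_nat leq_maxr.
  have rW : N%:R * r N <= W.
    apply: le_trans (HW N).
    have -> : N%:R * r N = \sum_(0 <= t < N) r N.
      by rewrite big_const_nat iter_addr_0 subn0 mulr_natl.
    by rewrite !big_nat; apply: ler_sum => t /andP[_ /ltnW]; exact: r_le.
  rewrite -(ltr_pM2l N0) mulrCA.
  apply: (@le_lt_trans _ _ (L * W)); first by rewrite ler_pM2l.
  move: NW; rewrite ltr_pdivrMr//; lra.
have g0 : 0 <= g 0%N by exact: G0.
have := tel N; have [_ gN] := gE N; have := HT N TN.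
rewrite !(@big_cat_nat _ _ _ T 0 N)//=.
have q1 : 0 <= \sum_(T <= t < N) q t by exact: sumr_ge0.
have q2 : \sum_(0 <= t < T) r t <= \sum_(0 <= t < T) q t.
  by rewrite !big_nat; apply: ler_sum => t /andP[_]; exact: rq.
have r1' : 1 <= \sum_(0 <= t < T) r t.
  by rewrite big_ltn// r_0 lerDl sumr_ge0.
have rN0 : 0 <= g 0%N * r N by rewrite mulr_ge0.
(* As the sum of r over t < T is at least 1, [delta] is at most delta times this sum, hence at most
   g_N plus [C] times the tail, which is below 2 delta / 3. *)
nra.
Qed.

End necessity.

(** * Backlog scanning and its invariant *)

Lemma addvE (n : nat) (u v : 'cV[nat]_n) j :
  (u + v)%R j ord0 = (u j ord0 + v j ord0)%N.
Proof. by rewrite mxE. Qed.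

Lemma subvE (n : nat) (u v : 'cV[nat]_n) j :
  (subv u v) j ord0 = (u j ord0 - v j ord0)%N.
Proof. by rewrite mxE. Qed.

Lemma deltavE (n : nat) (i j : 'I_n) :
  (delta_mx i 0 : 'cV[nat]_n) j ord0 = (j == i).
Proof. by rewrite mxE eqxx andbT; case: (j == i). Qed.

Lemma mulvE (n m : nat) (A : 'M[nat]_(n, m)) (s : 'cV[nat]_m) j :
  (A *m s) j ord0 = (\sum_k A j k * s k ord0)%N.
Proof. by rewrite mxE. Qed.

Section scan.
Variables (n m : nat) (A : 'M[nat]_(n, m)).
Implicit Types (U L : 'cV[nat]_n) (B : seq (entry n m)).

Definition within B := forall e, e \in B -> forall j, (e.2 j ord0 <= A j e.1)%N.
Definition filled j B := forall e, e \in B -> e.2 j ord0 = A j e.1.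
Definition required j B : nat := (\sum_(e <- B) A j e.1)%N.

Lemma within_cons e B : within (e :: B) ->
  (forall j, (e.2 j ord0 <= A j e.1)%N) /\ within B.
Proof.
move=> H; split => [|e' e'B]; first exact: H (mem_head _ _).
by apply: H; rewrite inE e'B orbT.
Qed.

Lemma assigned_cons e B j : assigned (e :: B) j ord0 = (e.2 j ord0 + assigned B j ord0)%N.
Proof. by rewrite /assigned big_cons mxE. Qed.

Lemma assigned_cat B B' j :
  assigned (B ++ B') j ord0 = (assigned B j ord0 + assigned B' j ord0)%N.
Proof. by rewrite /assigned big_cat mxE. Qed.

Lemma assigned_le_required B j : within B -> (assigned B j ord0 <= required j B)%N.
Proof.
elim: B => [|e B IH] /=; first by rewrite /assigned /required !big_nil mxE.
move=> /within_cons[eA BA]; rewrite assigned_cons /required big_cons.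
by apply: leq_add => //; exact: IH.
Qed.

Lemma filled_of_eq B j : within B -> assigned B j ord0 = required j B -> filled j B.
Proof.
elim: B => [|e B IH]; first by move=> _ _ e; rewrite in_nil.
move=> /within_cons[eA BA]; rewrite assigned_cons /required big_cons -/(required j B).
have := assigned_le_required j BA; have := eA j => h1 h2 h3.
have e1 : e.2 j ord0 = A j e.1 by lia.
have e2 : assigned B j ord0 = required j B by lia.
move=> e'; rewrite inE => /orP[/eqP ->//|]; exact: IH.
Qed.

Lemma assigned_filled B j : filled j B -> assigned B j ord0 = required j B.
Proof.
elim: B => [|e B IH] H; first by rewrite /assigned /required !big_nil mxE.
rewrite assigned_cons /required big_cons H ?mem_head// IH// => e' e'B.
by apply: H; rewrite inE e'B orbT.
Qed.

Lemma completeP (e : entry n m) :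
  reflect (forall j, e.2 j ord0 = A j e.1) (complete A e).
Proof.
apply: (iffP eqP) => [-> j|H]; first by rewrite mxE.
by apply/matrixP => j k; rewrite ord1 H mxE.
Qed.

Lemma scan_keys U B : map fst (scan A U B) = map fst B.
Proof. by elim: B U => //= -[k c] B IH U /=; rewrite IH. Qed.

Lemma required_scan U B j : required j (scan A U B) = required j B.
Proof.
have E B' : required j B' = (\sum_(k <- map fst B') A j k)%N by rewrite big_map.
by rewrite !E scan_keys.
Qed.

Lemma within_scan U B : within B -> within (scan A U B).
Proof.
elim: B U => [//|[k c] B IH] U /within_cons[/= cA BA] e; rewrite inE => /orP[/eqP -> j|].
  by rewrite /= addvE mxE; have := cA j; lia.
exact: IH.
Qed.

(** Class by class the scan is greedy: either the pool runs out or every entry gets all it lacks.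
    [L] is the pool after the scan. *)
Lemma scan_leftover U B : within B -> exists L : 'cV[nat]_n, forall j,
  [/\ (assigned (scan A U B) j ord0 + L j ord0 = assigned B j ord0 + U j ord0)%N,
      (L j ord0 <= U j ord0)%N & L j ord0 = 0%N \/ filled j (scan A U B)].
Proof.
elim: B U => [|[k c] B IH] U.
  by move=> _; exists U => j; split => //; right => e; rewrite in_nil.
move=> /within_cons[/= cA BA].
set g := \col_j minn (U j ord0) (A j k - c j ord0)%N.
have [L HL] := IH (subv U g) BA; exists L => j; have [h1 h2 h3] := HL j.
have gj : g j ord0 = minn (U j ord0) (A j k - (c : 'cV[nat]_n) j ord0).
  by rewrite mxE.
have sj := subvE U g j.
rewrite !assigned_cons /= addvE; split; [move: cA => /(_ j); lia|lia|].
case: h3 => [->|h3]; first by left.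
have [gA|gA] := leqP (A j k - (c : 'cV[nat]_n) j ord0) (U j ord0); last by left; lia.
right => e; rewrite inE => /orP[/eqP -> /=|]; last exact: h3.
by rewrite /= addvE gj; have := cA j; lia.
Qed.

(** An entry that becomes complete receives at least one item. Completions are thus bounded by newly
    assigned items, whatever the length of the list. *)
Lemma count_complete_scan U B : within B -> (forall e, e \in B -> ~~ complete A e) ->
  (\sum_j assigned B j ord0 + count (complete A) (scan A U B) <=
   \sum_j assigned (scan A U B) j ord0)%N.
Proof.
elim: B U => [|[k c] B IH] U; first by rewrite addn0.
move=> /within_cons[/= cA BA] nc.
have nck : ~~ complete A (k, c) by apply: nc; exact: mem_head.
have {}nc e : e \in B -> ~~ complete A e by move=> eB; apply: nc; rewrite inE eB orbT.
set g := \col_j minn (U j ord0) (A j k - c j ord0)%N.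
have := IH (subv U g) BA nc => {}IH.
under eq_bigr do rewrite assigned_cons.
under [X in (_ <= X)%N]eq_bigr do rewrite assigned_cons.
rewrite !big_split /=.
pose c' : 'cV[nat]_n := c.
rewrite addnACA; apply: leq_add; last exact: IH.
change (\sum_j c' j ord0 + complete A (k, (c' + g)%R) <= \sum_j (c' + g)%R j ord0)%N.
have le j : (c' j ord0 <= (c' + g)%R j ord0)%N by rewrite addvE leq_addr.
case: (boolP (complete A (k, (c' + g)%R))) => [kc|_] /=; last by rewrite addn0; exact: leq_sum.
rewrite addn1; have [j cgj] : exists j, (c' j ord0 < (c' + g)%R j ord0)%N.
  apply/not_existsP => H; case/negP: nck; apply/completeP => j /=.
  have /completeP/(_ j) /= <- := kc.
  by apply/eqP; rewrite eqn_leq le leqNgt; apply/negP; exact: H.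
rewrite (bigD1 j)//= [X in (_ < X)%N](bigD1 j)//= -addSn.
by apply: leq_add => //; exact: leq_sum.
Qed.

Lemma sum_count_entry (P : pred (entry n m)) B (f : 'I_m -> nat) :
  (\sum_k f k * count (fun e : entry n m => P e && (e.1 == k)) B =
   \sum_(e <- B | P e) f e.1)%N.
Proof.
elim: B => [|e B IH] /=.
  by rewrite big_nil big1// => k _; rewrite muln0.
rewrite big_cons; under eq_bigr do rewrite mulnDr.
rewrite big_split /= IH; case: (P e) => /=; last first.
  by rewrite big1 ?add0n// => k _; rewrite muln0.
congr (_ + _)%N; rewrite (bigD1 e.1)//= eqxx muln1 big1 ?addn0// => k.
by rewrite eq_sym => /negbTE ->; rewrite muln0.
Qed.

Lemma big_new_entries (s : 'cV[nat]_m) (f : entry n m -> nat) :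
  (\sum_(e <- new_entries n s) f e = \sum_k s k ord0 * f (k, 0%R))%N.
Proof.
rewrite /new_entries big_flatten big_map enumT; apply: eq_bigr => k _.
by rewrite big_nseq iter_addn_0 mulnC.
Qed.

Lemma required_new_entries (s : 'cV[nat]_m) j : required j (new_entries n s) = (A *m s) j ord0.
Proof.
rewrite /required big_new_entries mxE; apply: eq_bigr => k _.
by rewrite mulnC.
Qed.

Lemma mem_new_entries (s : 'cV[nat]_m) e : e \in new_entries n s -> e.2 = 0.
Proof. by case/flatten_mapP => k _ /nseqP[-> _]. Qed.

Lemma assigned_new_entries (s : 'cV[nat]_m) j : assigned (new_entries n s) j ord0 = 0%N.
Proof.
rewrite /assigned summxE big_new_entries big1// => k _.
by rewrite mxE muln0.
Qed.

Lemma assignedE B j : assigned B j ord0 = (\sum_(e <- B) e.2 j ord0)%N.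
Proof. by rewrite /assigned summxE. Qed.

(** The first two clauses are the constraints on entries that their type leaves out; the third makes
    the truncated subtraction defining the unassigned pool exact. *)
Definition vqml_inv (x : 'cV[nat]_n) (z : 'cV[int]_n * seq (entry n m)) : Prop :=
  [/\ within z.2, forall e, e \in z.2 -> ~~ complete A e,
      forall j, (assigned z.2 j ord0 <= x j ord0)%N,
      forall j, (x j ord0)%:Z = z.1 j ord0 + (required j z.2)%:Z &
      forall j, x j ord0 = assigned z.2 j ord0 \/ filled j z.2].

Lemma vqml_inv_init : vqml_inv 0 (0, [::]).
Proof.
split => //= j.
- by rewrite /assigned big_nil !mxE.
- by rewrite /required big_nil !mxE.
- by right => e; rewrite in_nil.
Qed.

(* The excess [x - W] and the missing items of a class are the positive and
   negative parts of the virtual queue, so that [q = 0] forces an empty list. *)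
Lemma vqml_inv_q0 x B : vqml_inv x (0, B) -> (x, B) = (0, [::]).
Proof.
move=> [/= BA nc xW xq xf].
have fill j : filled j B.
  have [xWj|//] := xf j; apply: filled_of_eq => //; rewrite -xWj.
  by have := xq j; rewrite mxE; lia.
have B0 : B = [::].
  case: B BA nc xW xq xf fill => // e B _ nc _ _ _ fill.
  case/negP: (nc e (mem_head _ _)); apply/completeP => j.
  by apply: fill; exact: mem_head.
congr (_, _) => //; apply/matrixP => j k; rewrite ord1.
have : Posz (x j ord0) = Posz 0.
  by rewrite xq B0 /required big_nil addr0 mxE.
by rewrite mxE => -[].
Qed.

Hypothesis A_neq0 : forall k : 'I_m, col k A != 0.
Hypothesis choice2 : forall q, (norm1 (virtual_choice A q) <= 2)%N.

Lemma mulmx_choice_le q j : ((A *m virtual_choice A q) j ord0 <= 2 * \sum_k A j k)%N.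
Proof.
rewrite mulvE big_distrr /=; apply: leq_sum => k _; rewrite mulnC leq_mul2r.
apply/orP; right; apply: leq_trans (choice2 q).
by rewrite /norm1 (bigD1 k)//= leq_addr.
Qed.

(** Activations are bounded by the items assigned during the epoch. In a class without unassigned
    items only the arrival can be assigned; in a class that no entry lacks, only the demand of the
    new entries can be served. *)
Lemma vqml_inv_step x z i : vqml_inv x z ->
  [/\ lev (A *m (vqml_step A x z i).1) (x + delta_mx i 0),
      (norm1 (vqml_step A x z i).1 <= \sum_j (1 + 2 * \sum_k A j k))%N &
      vqml_inv (next_queues A x i (vqml_step A x z i).1) (vqml_step A x z i).2].
Proof.
case: z => q B [/= BA nc xW xq xf].
set s := virtual_choice A q.
set U := subv x (assigned B) + delta_mx i 0.
set B1 := B ++ new_entries n s.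
set B' := scan A U B1; set sc := \col_k _.
have B1A : within B1.
  move=> e; rewrite mem_cat => /orP[/BA//|/mem_new_entries -> j].
  by rewrite mxE.
have nc1 e : e \in B1 -> ~~ complete A e.
  rewrite mem_cat => /orP[/nc//|/mem_new_entries e0].
  apply/negP => /eqP ce; case/negP: (A_neq0 e.1).
  by rewrite -ce e0.
have B'A : within B' by exact: within_scan.
have [L HL] := scan_leftover U B1A; rewrite -/B' in HL.
have Ac j : (A *m sc) j ord0 = (\sum_(e <- B' | complete A e) e.2 j ord0)%N.
  rewrite mulvE /sc; under eq_bigr do rewrite mxE.
  rewrite (sum_count_entry (complete A) B' (A j)).
  by apply: eq_bigr => e /completeP ->.
have split' (f : entry n m -> nat) : (\sum_(e <- B') f e =
   \sum_(e <- B' | complete A e) f e +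
   \sum_(e <- [seq e <- B' | ~~ complete A e]) f e)%N.
  by rewrite big_filter (bigID (complete A)).
have aB1 j : assigned B1 j ord0 = assigned B j ord0.
  by rewrite assigned_cat assigned_new_entries addn0.
have rB' j : required j B' = (required j B + (A *m s) j ord0)%N.
  by rewrite required_scan /required big_cat -/(required j B) -required_new_entries.
have Uj j : U j ord0 = (x j ord0 - assigned B j ord0 + (j == i))%N.
  by rewrite addvE subvE deltavE.
have xj j : (x + delta_mx i 0) j ord0 = (x j ord0 + (j == i))%N.
  by rewrite addvE deltavE.
have q'j j : (q + delta_mx i 0 - map_mx Posz (A *m s)) j ord0 =
    q j ord0 + (j == i)%:Z - ((A *m s) j ord0)%:Z.
  by rewrite !mxE eqxx andbT; case: (j == i).
have key j : (assigned B' j ord0 + L j ord0 = x j ord0 + (j == i))%N.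
  by have [-> _ _] := HL j; rewrite aB1 Uj; have := xW j; lia.
have feas : lev (A *m sc) (x + delta_mx i 0).
  move=> j; rewrite Ac xj -key assignedE (split' (fun e => e.2 j ord0)); lia.
split => //.
  have -> : norm1 sc = count (complete A) B'.
    rewrite /norm1 /sc; under eq_bigr do rewrite mxE.
    have := sum_count_entry (complete A) B' (fun=> 1%N).
    under eq_bigr do rewrite mul1n.
    by move=> ->; rewrite sum1_count.
  have cc := count_complete_scan U B1A nc1; rewrite -/B' in cc.
  rewrite -(leq_add2l (\sum_j assigned B1 j ord0)%N); apply: leq_trans cc _.
  rewrite -big_split /=; apply: leq_sum => j _; rewrite aB1.
  have t2 := mulmx_choice_le q j; rewrite -/s in t2.
  have k1 := key j; have b1 : ((j == i) <= 1)%N by case: (j == i).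
  have w1 := assigned_le_required j B'A; rewrite rB' in w1.
  have [xWE|fill] := xf j; first by lia.
  apply: leq_trans w1 _; rewrite (assigned_filled fill) leq_add2l.
  exact: leq_trans t2 (leq_addl _ _).
have x'j j : (next_queues A x i sc) j ord0 = (x j ord0 + (j == i) - (A *m sc) j ord0)%N.
  by rewrite /next_queues subvE xj.
set Bf := [seq e <- B' | ~~ complete A e].
have Ac' j : (A *m sc) j ord0 = (\sum_(e <- B' | complete A e) A j e.1)%N.
  by rewrite Ac; apply: eq_bigr => e /completeP ->.
have [a aE] : exists a : 'I_n -> nat, forall j, (A *m sc) j ord0 = a j.
  by exists (fun j => (A *m sc) j ord0).
have [t tE] : exists t : 'I_n -> nat, forall j, (A *m s) j ord0 = t j.
  by exists (fun j => (A *m s) j ord0).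
have aF j : assigned B' j ord0 = (a j + assigned Bf j ord0)%N.
  by rewrite -aE Ac !assignedE split'.
have rF j : (required j B + t j = a j + required j Bf)%N.
  by rewrite -tE -rB' -aE Ac' /required split'.
have le j : (a j <= x j ord0 + (j == i))%N by have := feas j; rewrite xj aE.
have {}x'j j : (next_queues A x i sc) j ord0 = (x j ord0 + (j == i) - a j)%N.
  by rewrite x'j aE.
have {}q'j j : (q + delta_mx i 0 - map_mx Posz (A *m s)) j ord0 =
    q j ord0 + (j == i)%:Z - (t j)%:Z by rewrite q'j tE.
split => /=.
- by move=> e; rewrite mem_filter => /andP[_]; exact: B'A.
- by move=> e; rewrite mem_filter => /andP[].
- move=> j; rewrite x'j; have := key j; have := aF j; lia.
- move=> j; rewrite x'j q'j; have := rF j; have := xq j; have := le j; lia.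
- move=> j; have [_ _ [L0|fill]] := HL j; last first.
    by right => e; rewrite mem_filter => /andP[_]; exact: fill.
  by left; rewrite x'j; have := key j; have := aF j; lia.
Qed.

End scan.

(** * Dynamics of the virtual queue *)

(** Vectors of norm at most [N] have entries in a finite ordinal, so the minimum is taken over a
    finite type. *)
Lemma ex_min_norm_le (d : Order.disp_t) (T : orderType d) (m N : nat)
    (f : 'cV[nat]_m -> T) (Q : 'cV[nat]_m -> Prop) :
  (forall s, Q s -> (norm1 s <= N)%N) -> (exists s, Q s) ->
  exists s, Q s /\ forall s', Q s' -> (f s <= f s')%O.
Proof.
move=> QN; pose emb (t : 'cV['I_N.+1]_m) : 'cV[nat]_m := map_mx val t.
have embP s : Q s -> exists t, emb t = s.
  move=> /QN sN; exists (map_mx inord s); apply/matrixP => k j.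
  rewrite ord1 !mxE /= inordK// ltnS; apply: leq_trans sN.
  by rewrite /norm1 (bigD1 k)//= leq_addr.
move=> [s0 Qs0]; have [t0 E0] := embP _ Qs0.
have Qt0 : `[< Q (emb t0) >] by apply/asboolP; rewrite E0.
case: (@Order.TotalTheory.arg_minP _ _ _ t0 (fun t => `[< Q (emb t) >])
  (fun t => f (emb t)) Qt0) => t /asboolP Qt tmin.
exists (emb t); split => // s' Qs'; have [t' E] := embP _ Qs'; move: Qs'; rewrite -E => Qs'.
by apply: tmin; exact/asboolP.
Qed.

Section virtual_choice.
Variables (n m : nat) (A : 'M[nat]_(n, m)).
Implicit Types (q : 'cV[int]_n) (s : 'cV[nat]_m).

Lemma virtual_choiceP q : canonical_choice A q (virtual_choice A q).
Proof.
apply: xgetPex; rewrite /canonical_choice /=.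
case: (asboolP (forall k : 'I_m, _)) => _; first by exists 0.
have [||s1 [s1n s1max]] := @ex_min_norm_le _ int m 2
  (fun s => - pairing q (A *m s)) (fun s => (norm1 s <= 2)%N) => //.
  by exists 0; rewrite /norm1 big1// => k _; rewrite mxE.
have Q1 : maximizer A q s1.
  by split => // s' /s1max; rewrite lerN2.
have [||s2 [Q2 s2min]] := @ex_min_norm_le _ nat m 2 (@norm1 m) (maximizer A q).
- by move=> s [].
- by exists s1.
have [||s3 [Q3 s3min]] := @ex_min_norm_le _ (seqlexi nat) m 2
  (fun s => [seq s k 0 | k <- enum 'I_m]) (min_norm_maximizer A q).
- by move=> s [[]].
- by exists s2.
by exists s3.
Qed.

Lemma virtual_choice0 q : (forall k, pairing q (col k A) <= 0) ->
  virtual_choice A q = 0.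
Proof. by move=> H; have := virtual_choiceP q; rewrite /canonical_choice asboolT. Qed.

Lemma pairing_mulmx q s : pairing q (A *m s) = \sum_k (s k 0)%:Z * pairing q (col k A).
Proof.
rewrite /pairing; under [RHS]eq_bigr do rewrite mulr_sumr.
rewrite exchange_big; apply: eq_bigr => j _ /=.
rewrite mulvE (big_morph Posz PoszD (erefl _)) mulr_sumr.
by apply: eq_bigr => k _; rewrite PoszM mxE; ring.
Qed.

Lemma virtual_choice_max q : maximizer A q (virtual_choice A q).
Proof.
have [H|] := pselect (forall k, pairing q (col k A) <= 0).
  rewrite virtual_choice0//; split.
    by rewrite /norm1 big1// => k _; rewrite mxE.
  move=> s _; rewrite !pairing_mulmx [leRHS]big1; last first.
    by move=> k _; rewrite mxE mul0r.
  by apply: sumr_le0 => k _; rewrite mulr_ge0_le0.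
by move=> H; have := virtual_choiceP q; rewrite /canonical_choice asboolF// => -[[]].
Qed.

Lemma virtual_choice_le2 q : (norm1 (virtual_choice A q) <= 2)%N.
Proof. by have [] := virtual_choice_max q. Qed.

Lemma norm1E s : norm1 s = (\sum_k s k ord0)%N.
Proof. by []. Qed.

Lemma pairing_choice_ge0 q : 0 <= pairing q (A *m virtual_choice A q).
Proof.
have [_ /(_ 0)] := virtual_choice_max q; rewrite mulmx0 => H; apply: le_trans (H _).
  by rewrite /pairing big1// => j _; rewrite mxE mulr0.
by rewrite /norm1 big1// => k _; rewrite mxE.
Qed.

Lemma pairing_choice_ge q k :
  2 * pairing q (col k A) <= pairing q (A *m virtual_choice A q).
Proof.
have [_ /(_ (2 *: delta_mx k 0))] := virtual_choice_max q => H; apply: le_trans (H _).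
  rewrite pairing_mulmx (bigD1 k)//= big1 ?addr0.
    by rewrite !mxE !eqxx.
  by move=> j jk; rewrite !mxE (negbTE jk) /= mulr0 mul0r.
rewrite /norm1 (bigD1 k)//= big1.
  by rewrite !mxE !eqxx.
by move=> j jk; rewrite !mxE (negbTE jk) /= mulr0.
Qed.

Lemma sum_nat_gt0 (f : 'I_m -> nat) : (0 < \sum_k f k)%N -> exists k, (0 < f k)%N.
Proof.
move=> f0; apply/not_existsP => H; move: f0; rewrite big1// => k _.
by apply/eqP; rewrite -leqn0 leqNgt; apply/negP; exact: H.
Qed.

(** Doubling a heaviest edge yields twice its weight, so a maximizer spends both activations, and
    none on an edge of nonpositive weight. [k] and [k'] may coincide, for an edge activated
    twice. *)
Lemma virtual_choice_match q k0 : 0 < pairing q (col k0 A) ->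
  exists k k', [/\ 0 < pairing q (col k A), 0 < pairing q (col k' A) &
    forall i, (A i k + A i k' <= (A *m virtual_choice A q) i ord0)%N].
Proof.
move=> wk0; pose w k := pairing q (col k A).
have [kM _ wM] := @Order.TotalTheory.arg_maxP _ int 'I_m k0 xpredT w isT.
have {wk0}wM0 : 0 < w kM by apply: lt_le_trans (wM k0 isT).
set s := virtual_choice A q.
have s2 : (norm1 s <= 2)%N := virtual_choice_le2 q.
have ge2 : 2 * w kM <= \sum_k (s k 0)%:Z * w k.
  by rewrite -pairing_mulmx; exact: pairing_choice_ge.
have normE (P : pred 'I_m) : \sum_(k | P k) (s k 0)%:Z * w k <=
    (\sum_(k | P k) s k ord0)%N%:Z * w kM.
  rewrite (big_morph Posz PoszD (erefl _)) mulr_suml; apply: ler_sum => k _.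
  by rewrite ler_wpM2l//; exact: wM.
have n2 : norm1 s = 2%N.
  apply/eqP; rewrite eqn_leq s2 /= leqNgt; apply/negP => s1.
  have := normE xpredT; rewrite -norm1E.
  have : (norm1 s)%:Z * w kM <= 1 * w kM by rewrite ler_pM2r// lez_nat.
  lia.
have pos k : (0 < s k ord0)%N -> 0 < w k.
  move=> sk; rewrite ltNge; apply/negP => wk.
  have := n2; rewrite norm1E (bigD1 k)//=.
  set S := (\sum_(j | _) _)%N => nk.
  have h1 : \sum_k (s k 0)%:Z * w k <= 0 + S%:Z * w kM.
    rewrite (bigD1 k)//=; apply: lerD; last exact: (normE (predC1 k)).
    by rewrite mulr_ge0_le0.
  have h2 : S%:Z * w kM <= 1 * w kM by rewrite ler_pM2r// lez_nat; lia.
  have := le_trans ge2 h1; rewrite add0r => /le_trans/(_ h2).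
  move: wM0; move: (w kM) => c; lia.
have [k sk] : exists k, (0 < s k ord0)%N by apply: sum_nat_gt0; rewrite -norm1E n2.
(* One unit of [k] is withdrawn first, so that k' = k is possible only if [k] is activated twice. *)
have [k' sk'] : exists k', (0 < s k' ord0 - (k' == k))%N.
  apply: sum_nat_gt0; rewrite (bigD1 k)//= eqxx.
  have := n2; rewrite norm1E (bigD1 k)//=.
  under [X in (0 < _ + X)%N]eq_bigr => j /negbTE -> do rewrite subn0.
  lia.
exists k, k'; split; [exact: pos|apply: pos; lia|].
move=> i; rewrite mulvE.
have [kk|kk] := eqVneq k' k.
  rewrite (bigD1 k)//= kk; apply: leq_trans (leq_addr _ _).
  by rewrite addnn -mul2n mulnC leq_mul2l; apply/orP; right; move: sk'; rewrite kk eqxx; lia.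
rewrite (bigD1 k)//= (bigD1 k')//= addnA; apply: leq_trans (leq_addr _ _).
rewrite (negbTE kk) subn0 in sk'.
by apply: leq_add; rewrite leq_pmulr.
Qed.

(** * Arrival sequences that empty the virtual queue *)

Definition virtual_step q i : 'cV[int]_n :=
  q + delta_mx i 0 - map_mx Posz (A *m virtual_choice A q).

Lemma virtual_stepE q i j : virtual_step q i j 0 =
  q j 0 + (j == i)%:Z - ((A *m virtual_choice A q) j ord0)%:Z.
Proof. by rewrite !mxE eqxx andbT; case: (j == i). Qed.

Definition pospart (z : int) : nat := if z is Posz k then k else 0%N.
Definition posv q : nat := (\sum_j pospart (q j 0%R))%N.
Definition negv q : nat := (\sum_j pospart (- q j 0%R))%N.
Definition norml1 q : nat := (\sum_j `|q j 0%R|)%N.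
Definition gain : nat := (\sum_j 2 * \sum_k A j k)%N.
(** One epoch raises the negative part by at most [gain]; the weight [gain.+1] lets the loss of one
    positive unit outweigh this. *)
Definition potential q : nat := (gain.+1 * posv q + negv q)%N.

Lemma pospartE z : (pospart z)%:Z = if 0 <= z then z else 0.
Proof. by case: z. Qed.

Lemma potential_le q : (potential q <= gain.+1 * norml1 q)%N.
Proof.
have -> : norml1 q = (posv q + negv q)%N.
  rewrite -big_split; apply: eq_bigr => j _ /=.
  have := pospartE (q j 0); have := pospartE (- q j 0).
  by case: ifP; case: ifP; lia.
by rewrite mulnDr leq_add2l leq_pmull.
Qed.

Lemma pairing_gt0 q (v : 'cV[nat]_n) : 0 < pairing q v ->
  exists j, 0 < q j 0 /\ (0 < v j ord0)%N.
Proof.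
apply: contraPP => H; apply/negP; rewrite -leNgt; apply: sumr_le0 => j _.
have [v0|v0] := posnP (v j ord0); first by rewrite v0 mulr0.
rewrite mulr_le0_ge0// leNgt; apply/negP => q0; by apply: H; exists j.
Qed.

(** If some edge has positive weight, two such matches are made, each meeting a class with positive
    queue: an arrival in the class met by the first is absorbed, and the second still lowers the
    positive part. Otherwise nothing is matched and some queue is negative, for a nonzero
    nonnegative q would give positive weight to an edge; an arrival there repays one unit. *)
Lemma potential_decreases q : (forall i, exists k, (0 < A i k)%N) -> q != 0 ->
  exists i, (potential (virtual_step q i) < potential q)%N.
Proof.
move=> edge q0.
have [[k0 wk0]|/forallNP H] := pselect (exists k, 0 < pairing q (col k A)).
  have [k [k' [/pairing_gt0[i [qi Ai]] /pairing_gt0[j [qj Aj]] tk]]] :=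
    virtual_choice_match wk0.
  rewrite mxE in Ai; rewrite mxE in Aj.
  exists i; set t := A *m virtual_choice A q in tk *.
  have E l := virtual_stepE q i l; rewrite -/t in E.
  have p1 : ((posv (virtual_step q i)).+1 <= posv q)%N.
    rewrite /posv (bigD1 j)//= [X in (_ <= X)%N](bigD1 j)//= -addSn.
    apply: leq_add; last first.
      apply: leq_sum => l _; have := pospartE (q l 0).
      have := pospartE (virtual_step q i l 0); rewrite E.
      have := tk l; have [->|li] := eqVneq l i; case: ifP; case: ifP; lia.
    have := pospartE (q j 0).
    have := pospartE (virtual_step q i j 0); rewrite E.
    have := tk j; have [ji|ji] := eqVneq j i; rewrite ?ji; rewrite ?ji in qj Aj;
      case: ifP; case: ifP; lia.
  have n1 : (negv (virtual_step q i) <= negv q + gain)%N.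
    rewrite /negv /gain -big_split /=; apply: leq_sum => l _.
    have := pospartE (- q l 0).
    have := pospartE (- virtual_step q i l 0); rewrite E.
    have := mulmx_choice_le virtual_choice_le2 q l; rewrite -/t.
    move: (2 * _)%N => u; case: ifP; case: ifP; case: (l == i); lia.
  rewrite /potential; move: p1 n1.
  move: (posv _) (posv _) (negv _) (negv _) => a b c d.
  move=> /(leq_mul (leqnn gain.+1)); rewrite mulnS; lia.
have {}H k : pairing q (col k A) <= 0 by rewrite leNgt; exact/negP.
have s0 := virtual_choice0 H.
have [i qi] : exists i, q i 0 < 0.
  apply/not_existsP => nq; have qp i : 0 <= q i 0 by rewrite leNgt; exact/negP.
  have [i qi] : exists i, 0 < q i 0.
    apply/not_existsP => nq'; case/negP: q0; apply/eqP/matrixP => i j.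
    rewrite ord1 mxE; apply/eqP; rewrite eq_le qp andbT leNgt; exact/negP.
  have [k Ak] := edge i; have := H k; rewrite leNgt => /negP; apply.
  rewrite /pairing (bigD1 i)//= ltr_pwDl//; last first.
    by apply: sumr_ge0 => j _; rewrite mulr_ge0.
  by rewrite mxE mulr_gt0.
exists i; have E j : virtual_step q i j 0 = q j 0 + (j == i)%:Z.
  by rewrite virtual_stepE s0 mulmx0 mxE subr0.
rewrite /potential; have -> : posv (virtual_step q i) = posv q.
  apply: eq_bigr => j _; rewrite E; have := pospartE (q j 0).
  have := pospartE (q j 0 + (j == i)%:Z).
  by have [->|_] := eqVneq j i; case: ifP; case: ifP; lia.
rewrite ltn_add2l /negv (bigD1 i)//= [X in (_ < X)%N](bigD1 i)//= -addSn.
apply: leq_add.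
  have -> : virtual_step q i i 0 = q i 0 + 1 by rewrite E eqxx.
  have := pospartE (- q i 0); have := pospartE (- (q i 0 + 1)).
  by case: ifP; case: ifP; lia.
by apply: leq_sum => j /negbTE ji; rewrite E ji addr0.
Qed.

Lemma virtual_word q : (forall i, exists k, (0 < A i k)%N) ->
  exists w : seq 'I_n, (size w <= potential q)%N /\ foldl virtual_step q w = 0.
Proof.
move=> edge; have [N] := ubnP (potential q); elim: N q => // N IH q qN.
have [->|q0] := eqVneq q 0; first by exists [::].
have [i qi] := potential_decreases edge q0.
have [|w [ws w0]] := IH (virtual_step q i); first by lia.
by exists (i :: w); split => //=; apply: leq_trans qi; rewrite ltnS.
Qed.

Lemma norml1_virtual_step q i :
  (norml1 (virtual_step q i) <= norml1 q + (1 + gain))%N.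
Proof.
have -> : 1%N = (\sum_(j < n) (j == i))%N.
  by rewrite (bigD1 i)//= eqxx big1 ?addn0// => j /negbTE ->.
rewrite /norml1 /gain -!big_split /=; apply: leq_sum => j _.
rewrite virtual_stepE; have := mulmx_choice_le virtual_choice_le2 q j.
by move: (2 * _)%N => u; case: (j == i); lia.
Qed.

End virtual_choice.

(** * Stability of VQML *)

Section vqml.
Variables (R : realType) (n m : nat) (A : 'M[nat]_(n, m)).
Hypotheses (n_gt0 : (0 < n)%N) (A_neq0 : forall k : 'I_m, col k A != 0).

Let p := VQML R A.

Lemma esum_rule_VQML x z i (G : 'cV[nat]_m * internal p -> \bar R) :
  (forall sz, 0 <= G sz)%E ->
  (\esum_(sz in [set: 'cV[nat]_m * internal p]) ((rule x z i sz)%:E * G sz) =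
   G (vqml_step A x z i))%E.
Proof.
move=> G0; rewrite (esumID [set vqml_step A x z i])//; last first.
  by move=> sz _; apply: mule_ge0 => //; rewrite lee_fin.
rewrite !setTI esum_set1 /= ?eqxx ?mul1e// esum1 ?adde0// => sz /eqP/negbTE.
by move=> ->; rewrite mul0e.
Qed.

Lemma rule_VQML_gt0 x (z : internal p) i sz :
  0 < rule x z i sz -> sz = vqml_step A x z i.
Proof. by rewrite /=; case: eqP => // _; rewrite ltxx. Qed.

Lemma reachable_vqml_inv x (z : internal p) : reachable A x z -> vqml_inv A x z.
Proof.
elim=> [|{}x {}z i s z' _ inv /rule_VQML_gt0 E]; first exact: vqml_inv_init.
have [_ _] := vqml_inv_step A_neq0 (virtual_choice_le2 A) i inv.
by rewrite -E.
Qed.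

Lemma VQML_policy : is_policy A p.
Proof.
split.
- by move=> x z i sz; exact: ler0n.
- move=> x z i; rewrite -[RHS](esum_rule_VQML x z i (fun=> lee01)).
  by apply: eq_esum => sz _; rewrite mule1.
- move=> x z i s z' /reachable_vqml_inv inv /rule_VQML_gt0 E.
  have [+ _ _] := vqml_inv_step A_neq0 (virtual_choice_le2 A) i inv.
  by rewrite -E.
- exists (\sum_j (1 + 2 * \sum_k A j k))%N.
  move=> x z i s z' /reachable_vqml_inv inv /rule_VQML_gt0 E.
  have [_ + _] := vqml_inv_step A_neq0 (virtual_choice_le2 A) i inv.
  by rewrite -E.
Qed.

Definition vqml_next (y : state p) (i : 'I_n) : state p :=
  (next_queues A y.1 i (vqml_step A y.1 y.2 i).1, (vqml_step A y.1 y.2 i).2).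

Lemma vqml_next_q y i : (vqml_next y i).2.1 = virtual_step A y.2.1 i.
Proof. by case: y => x [q B]. Qed.

Lemma foldl_vqml_next_q y w :
  (foldl vqml_next y w).2.1 = foldl (virtual_step A) y.2.1 w.
Proof. by elim: w y => //= i w IH y; rewrite IH vqml_next_q. Qed.

Lemma reachable_vqml_next y i : reachable A y.1 y.2 ->
  reachable A (vqml_next y i).1 (vqml_next y i).2.
Proof.
move=> yr; apply: reachable_step yr _.
by rewrite /= -surjective_pairing eqxx ltr01.
Qed.

Lemma reachable_foldl y w : reachable A y.1 y.2 ->
  reachable A (foldl vqml_next y w).1 (foldl vqml_next y w).2.
Proof. by elim: w y => //= i w IH y yr; apply: IH; exact: reachable_vqml_next. Qed.

Variable lambda : 'cV[R]_n.
Hypothesis lambda_gt0 : forall i, 0 < lambda i 0.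

Let P := transition A lambda (p := p).
Let rate i := lambda i 0 / \sum_j lambda j 0.

Lemma esum_vqml (y : state p) (G : state p -> \bar R) : (forall z, 0 <= G z)%E ->
  (\esum_(z in [set: state p]) (P y z * G z) =
   \sum_i (rate i)%:E * G (vqml_next y i))%E.
Proof.
move=> G0; rewrite esum_transition//.
apply: eq_bigr => i _; congr (_ * _)%E.
by rewrite (esum_rule_VQML y.1 y.2 i
  (G := fun sz => G (next_queues A y.1 i sz.1, sz.2))).
Qed.

Lemma step_prob_ge0 t (x y : state p) : (0 <= step_prob P t x y)%E.
Proof.
elim: t x => [|t IH] x /=; first by rewrite lee_fin.
apply: esum_ge0 => u _; apply: mule_ge0 => //.
by apply: transition_ge0 => //; exact: VQML_policy.
Qed.

Lemma step_prob_word t (x y : state p) : (0 < step_prob P t x y)%E ->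
  exists w, foldl vqml_next x w = y.
Proof.
elim: t x => [|t IH] x /=.
  by case: (eqVneq x y) => [-> _|_]; [exists [::]|rewrite ltxx].
move=> H; have [z [Pz tz]] : exists z, (0 < P x z)%E /\ (0 < step_prob P t z y)%E.
  apply/not_existsP => H0; move: H; rewrite esum1 ?ltxx// => z _.
  have S0 := step_prob_ge0 t z y.
  have : (0 <= P x z)%E by apply: transition_ge0 => //; exact: VQML_policy.
   rewrite le_eqVlt => /orP[/eqP <-|P0]; first by rewrite mul0e.
  move: S0; rewrite le_eqVlt => /orP[/eqP <-|S0]; first by rewrite mule0.
  by case: (H0 z).
have [w <-] := IH _ tz; have [i [s [/rule_VQML_gt0 E zE]]] :=
  transition_gt0 VQML_policy Pz.
exists (i :: w) => /=; congr (foldl _ _ _).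
by rewrite /vqml_next -E /= zE; case: (z).
Qed.

(** The word has at most t letters, hence probability at least d^t, and an earlier visit to [x] only
    helps. It is nonempty because survival counts visits from time 1 on. *)
Lemma survival_word (x y : state p) (d : R) w t : 0 < d -> (forall i, d <= rate i) ->
  reachable A y.1 y.2 -> w != [::] -> (size w <= t)%N -> foldl vqml_next y w = x ->
  survival P x t y <= 1 - d ^+ t.
Proof.
move=> d0 dle; have pol := VQML_policy.
have rate1 : \sum_i rate i = 1 by exact: sum_arrival.
have d1 : d <= 1.
  apply: le_trans (dle (Ordinal n_gt0)) _; rewrite -rate1 (bigD1 (Ordinal n_gt0))//=.
  by rewrite lerDl sumr_ge0// => i _; rewrite ltW// arrival_gt0.
have P0 : forall y z, (0 <= P y z)%E by exact: transition_ge0.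
have Pst y' : reachable A y'.1 y'.2 -> (\esum_(z in [set: state p]) P y' z = 1)%E.
  by move=> _; exact: transition_stochastic.
pose D := [set y' : state p | reachable A y'.1 y'.2].
have Pcl y' z : D y' -> (0 < P y' z)%E -> D z by exact: reachable_transition.
have S1 t' z : D z -> survival P x t' z <= 1.
  by move=> Dz; exact: (survival_le x P0 Pcl Pst Dz (leq0n t')).
elim: t w y => [|t IH] [|i w] y // yr _ /= wt wx.
pose h j := if vqml_next y j == x then 0 else survival P x t (vqml_next y j).
have -> : survival P x t.+1 y = \sum_j rate j * h j.
  apply/EFin_inj; rewrite -(survivalE x P0 Pcl Pst)//= /taboo esum_mkcond.
  transitivity (\esum_(z in [set: state p])
    (P y z * (if z == x then 0 else survival P x t z)%:E))%E.
    apply: eq_esum => z _; case: ifPn => zx.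
      have zx' : z != x by apply/eqP; move: zx; rewrite inE.
      rewrite (negbTE zx'); have [/eqP <-|Pyz] := boolP (0%E == P y z).
        by rewrite !mul0e.
      rewrite (survivalE x P0 Pcl Pst)//; apply: Pcl yr _.
      by rewrite lt_def eq_sym Pyz P0.
    by move/negP: zx; rewrite inE /= => /contrapT ->; rewrite eqxx mule0.
  rewrite esum_vqml; last by move=> z; rewrite lee_fin; case: ifP => // _; exact: (survival_ge0 x P0).
  by rewrite -sumEFin; apply: eq_bigr => j _; rewrite EFinM.
have h1 j : h j <= 1.
  by rewrite /h; case: ifP => // _; apply: S1; exact: reachable_vqml_next.
have hi : h i <= 1 - d ^+ t.
  rewrite /h; case: ifPn => [_|ix]; first by rewrite subr_ge0 exprn_ile1// ltW.
  apply: (IH w) => //; first exact: reachable_vqml_next.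
  by apply: contraNN ix => /eqP w0; rewrite -wx w0.
have rj j : 0 < rate j by exact: arrival_gt0.
have : \sum_j rate j * h j <= \sum_j rate j * (1 - (j == i)%:R * d ^+ t).
  apply: ler_sum => j _; rewrite ler_pM2l//.
  by have [->|_] := eqVneq j i; rewrite ?mul1r// mul0r subr0.
have -> : \sum_j rate j * (1 - (j == i)%:R * d ^+ t) = 1 - rate i * d ^+ t.
  rewrite -[X in X - rate i * _]rate1; under eq_bigr do rewrite mulrBr mulr1.
  rewrite sumrB; congr (_ - _); rewrite (bigD1 i)//= eqxx mul1r big1 ?addr0// => j.
  by move=> /negbTE ->; rewrite mul0r mulr0.
move=> /le_trans; apply; rewrite exprS lerD2l lerN2 ler_wpM2r//.
by rewrite exprn_ge0// ltW.
Qed.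

(** * Quadratic drift of the virtual queue *)

Definition energy (y : state p) : R := \sum_j ((y.2.1 j 0)%:~R) ^+ 2.

Let drift_cst : R := \sum_j (1 + (2 * \sum_k A j k)%N%:R) ^+ 2.

(** Minus half the linear part of the mean increment of [energy]. *)
Definition imbalance (q : 'cV[int]_n) : R :=
  \sum_j (q j 0)%:~R * (((A *m virtual_choice A q) j ord0)%:R - rate j).

Lemma energy_drift (y : state p) :
  \sum_i rate i * energy (vqml_next y i) <=
  energy y - 2 * imbalance y.2.1 + drift_cst.
Proof.
set q := y.2.1; pose t j : R := ((A *m virtual_choice A q) j ord0)%:R.
pose Q j : R := (q j 0)%:~R.
have rate1 : \sum_i rate i = 1 by exact: sum_arrival.
have rj j : 0 <= rate j by rewrite ltW// arrival_gt0.
have E i : energy (vqml_next y i) <=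
    energy y + (2 * Q i - 2 * \sum_j Q j * t j) + drift_cst.
  have -> : 2 * Q i = \sum_j 2 * Q j * (j == i)%:R.
    by rewrite (bigD1 i)//= eqxx mulr1 big1 ?addr0// => j /negbTE ->; rewrite mulr0.
  rewrite mulr_sumr -sumrB /energy /drift_cst -!big_split /=; apply: ler_sum => j _.
  rewrite vqml_next_q virtual_stepE -/q.
  have := mulmx_choice_le (virtual_choice_le2 A) q j.
  rewrite -(ler_nat R) -/(t j); move: (2 * _)%N => u tu.
  have t0 : 0 <= t j by exact: ler0n.
  rewrite rmorphB rmorphD /= -!pmulrn -/(t j) -/(Q j).
  by case: (j == i) => /=; nra.
have avg (a b c : R) : \sum_i rate i * (a + (2 * Q i - b) + c) =
    a - (b - 2 * \sum_i Q i * rate i) + c.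
  transitivity (\sum_i (rate i * (a - b + c) + 2 * (Q i * rate i))).
    by apply: eq_bigr => i _; ring.
  rewrite big_split /= -mulr_suml rate1 -mulr_sumr; ring.
have -> : energy y - 2 * imbalance q + drift_cst =
    \sum_i rate i * (energy y + (2 * Q i - 2 * \sum_j Q j * t j) + drift_cst).
  rewrite avg /imbalance; under eq_bigr do rewrite mulrBr.
  by rewrite sumrB mulrBr.
by apply: ler_sum => i _; rewrite ler_wpM2l.
Qed.

Hypothesis lambda_int : interior_point A lambda.

Lemma every_class_matched i : exists k, (0 < A i k)%N.
Proof.
have [_ [mu [mu0 muE]]] := lambda_int.
apply/not_existsP => H; have := lambda_gt0 i; rewrite -muE mxE big1 ?ltxx// => k _.
rewrite mxE; have := H k; move/negP; rewrite -leqNgt leqn0 => /eqP ->.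
by rewrite mul0r.
Qed.

(** Write w_k = <q, A_k>, 2M for the weight of the choice and nu for mu divided by the total rate.
    The imbalance equals sum_k nu_k (M - w_k) + (2 - sum_k nu_k) M, where w_k <= M; and sum_k nu_k
    <= 1, because each column has an entry at least 1 while the normalized rates sum to 1. The
    second term controls positive weights, the first negative ones. *)
Lemma imbalance_coercive : exists2 kappa : R, 0 < kappa &
  forall q, 0 <= imbalance q /\ (norml1 q)%:R <= kappa * imbalance q.
Proof.
have [surj [mu [mu0 muE]]] := lambda_int.
pose nu k := mu k 0 / \sum_j lambda j 0.
have L0 : 0 < \sum_j lambda j 0.
  by rewrite (bigD1 (Ordinal n_gt0))//= ltr_pwDl// sumr_ge0// => j _; exact: ltW.
have nu0 k : 0 < nu k by rewrite divr_gt0.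
have rateE j : rate j = \sum_k (A j k)%:R * nu k.
  rewrite /rate -{1}muE mxE mulr_suml; apply: eq_bigr => k _.
  by rewrite mxE /nu mulrA.
have nu1 : \sum_k nu k <= 1.
  have <- : \sum_i rate i = 1 by exact: sum_arrival.
  under [leRHS]eq_bigr do rewrite rateE.
  rewrite exchange_big; apply: ler_sum => k _; rewrite -mulr_suml.
  apply: ler_peMl; first exact: ltW.
  have [j Aj] : exists j, (0 < A j k)%N.
    apply/not_existsP => H; case/negP: (A_neq0 k); apply/eqP/matrixP => j l.
    by rewrite !mxE; apply/eqP; rewrite -leqn0 leqNgt; exact/negP.
  by rewrite (bigD1 j)//= -[leLHS]addr0; apply: lerD; rewrite ?sumr_ge0// ler1n.
have /choice[Y HY] : forall j : 'I_n, exists x : 'cV[R]_m,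
    real_mx R A *m x = delta_mx j 0 by move=> j; exact: surj.
(* From Q_j = sum_k Y_jk w_k and |w_k| <= imbalance / nu_k; the added 1 makes the constant
   positive. *)
exists (1 + \sum_j \sum_k `|Y j k 0| / nu k).
  rewrite ltr_pwDl// sumr_ge0// => j _; apply: sumr_ge0 => k _.
  by rewrite divr_ge0// ltW.
move=> q; pose Q j : R := (q j 0)%:~R.
pose w k := \sum_j Q j * (A j k)%:R.
pose M : R := (\sum_j Q j * ((A *m virtual_choice A q) j ord0)%:R) / 2.
have pairE (v : 'cV[nat]_n) : (pairing q v)%:~R = \sum_j Q j * (v j ord0)%:R.
  by rewrite /pairing rmorph_sum; apply: eq_bigr => j _; rewrite rmorphM.
have wE k : w k = (pairing q (col k A))%:~R.
  by rewrite pairE; apply: eq_bigr => j _; rewrite mxE.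
have Mw k : w k <= M.
  rewrite wE /M -pairE ler_pdivlMr// mulrC.
  have := pairing_choice_ge A q k; rewrite -(ler_int R) rmorphM /=.
  by apply: le_trans; rewrite lexx.
have M0 : 0 <= M.
  by rewrite /M -pairE divr_ge0// ler0z; exact: pairing_choice_ge0.
have gE : imbalance q = \sum_k nu k * (M - w k) + (2 - \sum_k nu k) * M.
  rewrite /imbalance; under eq_bigr do rewrite mulrBr.
  rewrite sumrB; have -> : \sum_j (q j 0)%:~R * rate j = \sum_k nu k * w k.
    under eq_bigr do rewrite rateE mulr_sumr.
    rewrite exchange_big; apply: eq_bigr => k _; rewrite /w mulr_sumr.
    by apply: eq_bigr => j _; rewrite -/(Q j); ring.
  under [in RHS]eq_bigr do rewrite mulrBr.
  rewrite sumrB -mulr_suml /M -/(Q _); lra.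
have gk k : nu k * `|w k| <= imbalance q.
  have h1 : nu k * (M - w k) <= \sum_k nu k * (M - w k).
    rewrite [leRHS](bigD1 k)//= lerDl sumr_ge0// => j _.
    by rewrite mulr_ge0 ?(ltW (nu0 j))// subr_ge0.
  have nk1 : nu k <= 1.
    by apply: le_trans nu1; rewrite (bigD1 k)//= lerDl sumr_ge0// => j _; exact: ltW.
  have h2 : M <= (2 - \sum_k nu k) * M by rewrite ler_peMl//; lra.
  have h3 : 0 <= nu k * (M - w k) by rewrite mulr_ge0 ?subr_ge0// ltW.
  rewrite gE; have := Mw k; have := nu0 k => nk0 wM.
  case: (ger0P (w k)) => w0; first by have : nu k * w k <= w k; nra.
  nra.
have g0 : 0 <= imbalance q.
  rewrite gE addr_ge0//; last by rewrite mulr_ge0//; lra.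
  by apply: sumr_ge0 => k _; rewrite mulr_ge0 ?subr_ge0// ltW.
split => //.
have QE j : Q j = \sum_k Y j k 0 * w k.
  transitivity (\sum_i Q i * (real_mx R A *m Y j) i 0).
    rewrite HY (bigD1 j)//= mxE !eqxx mulr1 big1 ?addr0// => i ij.
    by rewrite mxE (negbTE ij) mulr0.
  under eq_bigr do rewrite mxE mulr_sumr.
  rewrite exchange_big; apply: eq_bigr => k _; rewrite /w mulr_sumr.
  by apply: eq_bigr => i _; rewrite mxE; ring.
rewrite /norml1 natr_sum mulrDl mul1r -[leLHS]add0r; apply: lerD => //.
rewrite mulr_suml; apply: ler_sum => j _; rewrite mulr_suml.
have -> : `|q j 0%R|%N%:R = `|Q j| by rewrite /Q -intr_norm natr_absz.
rewrite QE; apply: le_trans (ler_norm_sum _ _ _) _; apply: ler_sum => k _.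
rewrite normrM -mulrA ler_wpM2l// ler_pdivlMl//.
Qed.

Lemma VQML_stabilizes : stabilizes A lambda p.
Proof.
move=> x [[t0 xt0] _]; have [w0 xw0] := step_prob_word xt0.
have pol := VQML_policy.
have P0 : forall y z, (0 <= P y z)%E by exact: transition_ge0.
have Pst y : reachable A y.1 y.2 -> (\esum_(z in [set: state p]) P y z = 1)%E.
  by move=> _; exact: transition_stochastic.
pose D := [set y : state p | reachable A y.1 y.2].
have Pcl y z : D y -> (0 < P y z)%E -> D z by exact: reachable_transition.
have Dinit : D (init_state p) by exact: reachable_init.
have Dx : D x by rewrite -xw0; exact: reachable_foldl.
have [kappa k0 Hk] := imbalance_coercive.
have rj j : 0 < rate j by exact: arrival_gt0.
have rate1 : \sum_i rate i = 1 by exact: sum_arrival.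
have c0 : 0 <= drift_cst by apply: sumr_ge0 => j _; exact: sqr_ge0.
(* Chosen so that outside [F] twice the imbalance exceeds drift_cst + 1, hence [energy] decreases by
   at least 1 in the mean. *)
pose Nb := (Num.truncn (kappa * (drift_cst + 1) / 2)).+1.
pose F (y : state p) := (norml1 y.2.1 < Nb)%N.
pose d : R := \prod_i rate i.
have d0 : 0 < d by exact: prodr_gt0.
have dle i : d <= rate i.
  rewrite /d (bigD1 i)//= ler_piMr ?(ltW (rj i))// prodr_ile1// => j _.
  rewrite (ltW (rj j)) /= -rate1 (bigD1 j)//= lerDl sumr_ge0// => l _; exact: ltW.
(* Bounds the length of a word from any state of [F] to [x]: one arbitrary arrival, a word emptying
   the virtual queue it leaves, then [w0]. *)
pose N := (1 + (gain A).+1 * (Nb + (1 + gain A)) + size w0)%N.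
apply: (@foster R (state p) P x P0 D Pcl Pst energy F (drift_cst + 1) (d ^+ N) N) => //.
- by move=> y; apply: sumr_ge0 => j _; exact: sqr_ge0.
- by rewrite addr_ge0.
- by rewrite exprn_gt0.
- move=> y Dy; rewrite (@esum_vqml y (fun z => (energy z)%:E)); last first.
    by move=> z; rewrite lee_fin; apply: sumr_ge0 => j _; exact: sqr_ge0.
  rewrite (eq_bigr (fun i => (rate i * energy (vqml_next y i))%:E)) //.
  rewrite sumEFin -EFinM -!EFinD lee_fin.
  have := energy_drift y; have [g0 gk] := Hk y.2.1.
  rewrite /F; case: ltnP => lN /=; first lra.
  have : kappa * (drift_cst + 1) / 2 < kappa * imbalance y.2.1.
    apply: lt_le_trans gk; apply: lt_le_trans (truncnS_gt _) _.
    by rewrite ler_nat.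
  rewrite -mulrA ltr_pM2l//; lra.
(* The arrival [i0] guarantees a nonempty word even when the queue is already 0 and [w0] is
   empty. *)
- move=> y Dy Fy; pose i0 := Ordinal n_gt0.
  have [w1 [sw1 w1E]] := virtual_word (vqml_next y i0).2.1 every_class_matched.
  have y2 : foldl vqml_next (vqml_next y i0) w1 = init_state p.
    have : D (foldl vqml_next (vqml_next y i0) w1).
      by apply: reachable_foldl; exact: reachable_vqml_next.
    have := foldl_vqml_next_q (vqml_next y i0) w1; rewrite w1E.
    case: (foldl _ _ _) => x' [q' B'] /= -> /reachable_vqml_inv/vqml_inv_q0[-> ->].
    by [].
  apply: (@survival_word x y d (i0 :: w1 ++ w0)) => //.
    rewrite /= size_cat /N -addnA add1n ltnS leq_add2r.
    apply: leq_trans sw1 _; apply: leq_trans (potential_le _ _) _.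
    rewrite leq_mul2l /= vqml_next_q; apply: leq_trans (norml1_virtual_step _ _ _) _.
    by rewrite leq_add2r ltnW.
  by rewrite /= foldl_cat y2.
Qed.

End vqml.

Theorem mainTheorem2 (R : realType) (n m : nat) (n_gt0 : (0 < n)%N)
    (A : 'M[nat]_(n, m)) (A_neq0 : forall k : 'I_m, col k A != 0) :
  [/\ is_policy A (VQML R A),
      forall lambda : 'cV[R]_n, (forall i, 0 < lambda i 0) ->
        (surjective_mx R A /\
         exists mu : 'cV[R]_m,
           (forall k, 0 < mu k 0) /\ real_mx R A *m mu = lambda) ->
        stabilizes A lambda (VQML R A),
      forall lambda : 'cV[R]_n, (forall i, 0 < lambda i 0) ->
        (surjective_mx R A /\
         exists mu : 'cV[R]_m,
           (forall k, 0 < mu k 0) /\ real_mx R A *m mu = lambda) <->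
        (cone A)° lambda &
      maximally_stable A (VQML R A)].
Proof.
split.
- exact: VQML_policy.
- by move=> lambda l0 lint; exact: VQML_stabilizes.
- by move=> lambda _; exact: interior_pointP.
move=> lambda l0 [p [pol stab]]; apply: VQML_stabilizes => //.
have [//|[v [v0 vA vl]]] := interior_point_or_separated A lambda.
case: (separated_not_recurrent n_gt0 l0 pol v0 vA vl); apply: stab.
by split; exists 0%N; rewrite /= eqxx lte01.
Qed.
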